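(* Let $\eta:\mathbb{T}\to\mathbb{R}^d$ and $V:\mathbb{T}^{d+1}\to\mathbb{R}$ be smooth functions, let $H(x,t,p)=\tfrac12|p+\eta(t)|^2+V(x,t)$, and let $L$ be the Legendre transform of $H$ in $p$. For each integer $k\ge1$ let $u_k:\mathbb{T}^{d+1}\to\mathbb{R}$ be the (smooth) minimizer of $I_k$ with $\int_{\mathbb{T}^{d+1}}u_k=0$, let $m_k(z)=e^{k(u_{k,t}(z)+H(z,\nabla u_k(z)))}/I_k[u_k]$, and let $\mu_k$ be the probability measure on $\mathbb{T}^{d+1}\times\mathbb{R}^d$ defined by $$\int_{\mathbb{T}^{d+1}\times\mathbb{R}^d}F(z,v)\,d\mu_k=\int_{\mathbb{T}^{d+1}}F(z,H_p(z,\nabla u_k(z)))\,m_k(z)\,dz$$ for all continuous $F:\mathbb{T}^{d+1}\times\mathbb{R}^d\to\mathbb{R}$. Let $(k_j)_{j}$ be a strictly increasing sequence of positive integers such that $\mu_{k_j}$ converges weakly to a probability measure $\mu$ on $\mathbb{T}^{d+1}\times\mathbb{R}^d$ as $j\to\infty$. Then (a) $\mu$ is a Mather measure; (b) $\displaystyle\lim_{j\to\infty}\frac1{k_j}S[\mu_{k_j}]=0$.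
   Context: $\mathbb{T}=\mathbb{R}/\mathbb{Z}$; points of $\mathbb{T}^{d+1}$ are written $z=(x,t)$ with $x\in\mathbb{T}^d$, $t\in\mathbb{T}$; $\nabla$ and $\operatorname{div}$ are taken in $x$ only, $u_t$ is the derivative in $t$. The Legendre transform is $L(z,v)=\sup_{p\in\mathbb{R}^d}(p\cdot v-H(z,p))$. For functions $u$ on $\mathbb{T}^{d+1}$, $$I_k[u]=\int_{\mathbb{T}^{d+1}}e^{k(u_t+H(x,t,\nabla u))}\,dx\,dt.$$ The minimizer $u_k$ is a smooth solution of the Euler–Lagrange equation $\bigl(e^{k(u_t+H(z,\nabla u))}\bigr)_t+\operatorname{div}\bigl(e^{k(u_t+H(z,\nabla u))}H_p(z,\nabla u)\bigr)=0$ on $\mathbb{T}^{d+1}$. For a Borel probability measure $\mu$ on $\mathbb{T}^{d+1}\times\mathbb{R}^d$ let $m_\mu$ be its push-forward to $\mathbb{T}^{d+1}$ under $(z,v)\mapsto z$. For a Borel probability measure $m$ on $\mathbb{T}^{d+1}$ that is absolutely continuous with respect to Lebesgue measure (density also denoted $m$) put $S^*[m]=\int_{\mathbb{T}^{d+1}}m(z)\log m(z)\,dz\in(-\infty,+\infty]$. For an arbitrary Borel probability measure $m$ on $\mathbb{T}^{d+1}$ let $\bar S[m]$ be the infimum of $\liminf_n S^*[m_n]$ over all sequences of absolutely continuous probability measures $m_n$ converging weakly to $m$ (the lower semicontinuous convex extension of $S^*$). Put $S[\mu]=\bar S[m_\mu]$. Let $\mathcal{C}$ be the set of Borel probability measures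 $\mu$ on $\mathbb{T}^{d+1}\times\mathbb{R}^d$ such that $\int|v|\,d\mu(z,v)<+\infty$ and $\int(\varphi_t+\nabla\varphi\cdot v)\,d\mu(x,t,v)=0$ for all $\varphi\in C^1(\mathbb{T}^{d+1})$. A Mather measure is a measure $\mu\in\mathcal{C}$ with $\int L\,d\mu=\min_{\nu\in\mathcal{C}}\int L\,d\nu$. *)

(* Defs.v *)
From HB Require Import structures.
From mathcomp Require Import all_boot all_order all_algebra.
From mathcomp Require Import all_classical all_reals all_analysis.

Set Implicit Arguments.
Unset Strict Implicit.
Unset Printing Implicit Defensive.

Import Order.TTheory GRing.Theory Num.Theory.
Import numFieldNormedType.Exports.

Local Open Scope classical_set_scope.
Local Open Scope ring_scope.

(* The sigma-algebra on R^n generated by the coordinate maps, as the library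
   does for tuples and for pairs.  R being second countable, this is the Borel
   sigma-algebra; likewise, the library's product sigma-algebras on
   'rV[R]_d * R and ('rV[R]_d * R) * 'rV[R]_d are the Borel ones. *)
Section measurable_rV.
Context (R : realType) (n : nat).

Let coors : 'I_n -> 'rV[R]_n -> R := fun i x => x ord0 i.

Let rV_set0 : g_sigma_preimage coors set0.
Proof. exact: sigma_algebra0. Qed.

Let rV_setC A : g_sigma_preimage coors A -> g_sigma_preimage coors (~` A).
Proof. exact: sigma_algebraC. Qed.

Let rV_bigcup (F : (set 'rV[R]_n)^nat) :
  (forall i, g_sigma_preimage coors (F i)) ->
  g_sigma_preimage coors (\bigcup_i (F i)).
Proof. exact: sigma_algebra_bigcup. Qed.

HB.instance Definition _ :=
  @isMeasurable.Build (measure_tuple_display default_measure_display)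
    'rV[R]_n (g_sigma_preimage coors) rV_set0 rV_setC rV_bigcup.

Lemma measurable_fun_rV d (T : measurableType d) (f : T -> 'rV[R]_n) :
  (forall i, measurable_fun [set: T] (fun x => f x ord0 i)) ->
  measurable_fun [set: T] f.
Proof.
move=> mf.
have sub : g_sigma_preimage (fun i => coors i \o f) `<=` measurable.
  apply: smallest_sub; first exact: sigma_algebra_measurable.
  rewrite /= => A.
  elim/big_ind : _ A => [//|A B HA HB C [|]|i _ A [B mB <-]].
  - exact: HA.
  - exact: HB.
  - exact: mf.
rewrite g_sigma_preimage_comp in sub.
by move=> _ A mA; apply: sub; exists A.
Qed.

Lemma measurable_coord i :
  measurable_fun [set: 'rV[R]_n] (fun x : 'rV[R]_n => x ord0 i).
Proof.
move=> _ Y mY; apply: sub_sigma_algebra.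
by rewrite (bigD1 i)//=; left; exists Y.
Qed.

End measurable_rV.

(* A point (x, t) of T^d x T is represented by a point of R^d x R.
   - Functions on T^{d+1} are functions on R^d x R that are 1-periodic in each
     coordinate, with their usual topological and differential properties.
   - Borel probability measures on T^{d+1} (resp. T^{d+1} x R^d) are Borel
     probability measures on R^d x R (resp. (R^d x R) x R^d) carried by the
     fundamental domain [0, 1)^{d+1} (resp. [0, 1)^{d+1} x R^d).  Integrals
     against them, and weak convergence, only involve periodic functions. *)
Notation spacetime R d := ('rV[R]_d * R)%type.
Notation phase R d := (spacetime R d * 'rV[R]_d)%type.

Section lebesgue_torus.
Context (R : realType).

(* measurableTypeR R and R carry the same Borel sigma-algebra, with different
   displays; the library's Lebesgue measure lives on the former. *)
Definition to_R (x : measurableTypeR R) : R := x.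

Lemma measurable_to_R : measurable_fun [set: measurableTypeR R] to_R.
Proof. exact: measurable_id. Qed.

HB.instance Definition _ :=
  isMeasurableFun.Build _ _ _ _ to_R measurable_to_R.

Definition lebesgue_unit : probability R R :=
  distribution (uniform_prob (@ltr01 R)) to_R.

Definition row_cons n (ax : R * 'rV[R]_n) : 'rV[R]_n.+1 :=
  row_mx (ax.1%:M : 'rV[R]_1) ax.2.

Lemma measurable_row_cons n : measurable_fun setT (@row_cons n).
Proof.
apply: measurable_fun_rV => i.
case: (@split_ordP 1 n i) => j -> /=.
- rewrite [X in measurable_fun _ X](_ : _ = fst); first exact: measurable_fst.
  apply/funext => -[a x] /=.
  by rewrite /row_cons (row_mxEl (a%:M : 'rV[R]_1) x) (ord1 j) mxE eqxx.
- rewrite [X in measurable_fun _ X](_ : _ =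
    (fun x : 'rV[R]_n => x ord0 j) \o snd).
    by apply: measurableT_comp => //; exact: measurable_coord.
  apply/funext => -[a x] /=.
  by rewrite /row_cons (row_mxEr (a%:M : 'rV[R]_1) x).
Qed.

HB.instance Definition _ n :=
  isMeasurableFun.Build _ _ _ _ (@row_cons n) (@measurable_row_cons n).

(* n-dimensional Lebesgue measure restricted to the unit cube *)
Fixpoint lebesgue_cube n : probability 'rV[R]_n R :=
  match n with
  | 0 => \d_ (0 : 'rV[R]_0)
  | n'.+1 => distribution (lebesgue_unit \x lebesgue_cube n')%E (@row_cons n')
  end.

Definition lebesgue_torus d : probability (spacetime R d) R :=
  (lebesgue_cube d \x lebesgue_unit)%E.

End lebesgue_torus.
Arguments lebesgue_torus {R} d.

Section torus.
Context (R : realType) (d : nat).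

Definition torus_box : set (spacetime R d) :=
  [set z : spacetime R d | (forall i, 0 <= z.1 ord0 i < 1) /\ 0 <= z.2 < 1].

Definition torus_periodic (f : spacetime R d -> R) : Prop :=
  (forall i, periodic f (delta_mx ord0 i, 0)) /\ periodic f (0, 1).

Definition torus_measure (m : set (spacetime R d) -> \bar R) : Prop :=
  m torus_box = 1%E.

Definition phase_measure (mu : set (phase R d) -> \bar R) : Prop :=
  mu (torus_box `*` setT) = 1%E.

Definition weak_cvg_torus (mn : nat -> set (spacetime R d) -> \bar R)
    (m : set (spacetime R d) -> \bar R) : Prop :=
  forall phi : spacetime R d -> R, continuous phi -> torus_periodic phi ->
    (fun n => \int[mn n]_z (phi z)%:E)%E @ \oo --> (\int[m]_z (phi z)%:E)%E.

Definition weak_cvg_phase (mun : nat -> set (phase R d) -> \bar R)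
    (mu : set (phase R d) -> \bar R) : Prop :=
  forall F : phase R d -> R, continuous F ->
    (forall v, torus_periodic (fun z => F (z, v))) ->
    (exists M, forall w, `|F w| <= M) ->
    (fun n => \int[mun n]_w (F w)%:E)%E @ \oo --> (\int[mu]_w (F w)%:E)%E.

End torus.

Section calculus.
Context (R : realType).

(* C^k regularity for finite-dimensional U, through directional derivatives *)
Fixpoint Ck (U W : normedModType R) (k : nat) (f : U -> W) : Prop :=
  match k with
  | 0 => continuous f
  | k'.+1 => (forall x, differentiable f x) /\
             forall v, Ck k' (fun x => 'D_v f x)
  end.

Definition smooth (U W : normedModType R) (f : U -> W) : Prop :=
  forall k, Ck k f.

Context (d : nat).

Definition dt (u : spacetime R d -> R) (z : spacetime R d) : R :=
  'D_((0, 1) : spacetime R d) u z.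

Definition grad (u : spacetime R d -> R) (z : spacetime R d) : 'rV[R]_d :=
  \row_i 'D_((delta_mx ord0 i, 0) : spacetime R d) u z.

Definition dot (p q : 'rV[R]_d) : R := \sum_i p ord0 i * q ord0 i.

(* `|v| is the sup norm on 'rV[R]_d *)
Definition enorm (v : 'rV[R]_d) : R := Num.sqrt (dot v v).

End calculus.

Section variational.
Context (R : realType) (d : nat) (H : spacetime R d -> 'rV[R]_d -> R).

Definition grad_p (z : spacetime R d) (p : 'rV[R]_d) : 'rV[R]_d :=
  \row_i 'D_(delta_mx ord0 i : 'rV[R]_d) (H z) p.

Definition legendre (z : spacetime R d) (v : 'rV[R]_d) : \bar R :=
  ereal_sup (range (fun p : 'rV[R]_d => (dot p v - H z p)%:E)).

Definition exp_weight (k : nat) (u : spacetime R d -> R)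
    (z : spacetime R d) : R :=
  expR (k%:R * (dt u z + H z (grad u z))).

Definition exp_action (k : nat) (u : spacetime R d -> R) : R :=
  \int[lebesgue_torus d]_z exp_weight k u z.

(* u is smooth, but competes against all C^1 functions, the natural domain of
   the functional; by C^1-density of smooth functions this is the same as
   competing against smooth functions only. *)
Definition smooth_minimizer (k : nat) (u : spacetime R d -> R) : Prop :=
  [/\ torus_periodic u, smooth u,
      \int[lebesgue_torus d]_z u z = 0 &
      forall w, torus_periodic w -> Ck 1 w -> exp_action k u <= exp_action k w].

Definition min_density (k : nat) (u : spacetime R d -> R)
    (z : spacetime R d) : R :=
  exp_weight k u z / exp_action k u.

Definition is_graph_measure (k : nat) (u : spacetime R d -> R)
    (mu : set (phase R d) -> \bar R) : Prop :=
  phase_measure mu /\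
  forall F : phase R d -> R, continuous F ->
    (forall v, torus_periodic (fun z => F (z, v))) ->
    (\int[mu]_w (F w)%:E =
     \int[lebesgue_torus d]_z
       (F (z, grad_p z (grad u z)) * min_density k u z)%:E)%E.

Definition admissible (mu : set (phase R d) -> \bar R) : Prop :=
  [/\ phase_measure mu,
      (\int[mu]_w (enorm w.2)%:E < +oo)%E &
      forall phi : spacetime R d -> R, torus_periodic phi -> Ck 1 phi ->
        (\int[mu]_w (dt phi w.1 + dot (grad phi w.1) w.2)%:E = 0)%E].

Definition is_mather (mu : probability (phase R d) R) : Prop :=
  admissible mu /\
  forall nu : probability (phase R d) R, admissible nu ->
    (\int[mu]_w legendre w.1 w.2 <= \int[nu]_w legendre w.1 w.2)%E.

End variational.

Section entropy.
Context (R : realType) (d : nat).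

Definition has_density (m : set (spacetime R d) -> \bar R)
    (f : spacetime R d -> R) : Prop :=
  [/\ measurable_fun setT f, (forall z, 0 <= f z) &
      forall A, measurable A -> m A = (\int[lebesgue_torus d]_(z in A) (f z)%:E)%E].

(* Differential entropy of the measure with density f.  ln 0 = 0 in the library, so the integrand is 0 where f vanishes. *)
Definition entropy_density (f : spacetime R d -> R) : \bar R :=
  (\int[lebesgue_torus d]_z (f z * ln (f z))%:E)%E.

(* The absolutely continuous probability measures are those with a density
   with respect to Lebesgue measure (Radon-Nikodym). *)
Definition entropy_lsc (m : set (spacetime R d) -> \bar R) : \bar R :=
  ereal_inf [set s | exists (mn : nat -> probability (spacetime R d) R)
                            (f : nat -> spacetime R d -> R),
    [/\ forall n, has_density (mn n) (f n),
        weak_cvg_torus (fun n => mn n) m &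
        s = limn_einf (fun n => entropy_density (f n))]].

Definition entropy (mu : set (phase R d) -> \bar R) : \bar R :=
  entropy_lsc (pushforward mu fst).

End entropy.

Definition mechanical_hamiltonian (R : realType) (d : nat)
    (eta : R -> 'rV[R]_d) (V : spacetime R d -> R)
    (z : spacetime R d) (p : 'rV[R]_d) : R :=
  2^-1 * enorm (p + eta z.2) ^+ 2 + V z.

(* Main.v *)
Require Import Defs.
From HB Require Import structures.
From mathcomp Require Import all_boot all_order all_algebra.
From mathcomp Require Import all_classical all_reals all_analysis.
From mathcomp Require Import measurable_realfun.
From mathcomp Require Import ring lra.
Set Implicit Arguments.
Unset Strict Implicit.
Unset Printing Implicit Defensive.
Import Order.TTheory GRing.Theory Num.Theory.
Import numFieldNormedType.Exports.
Local Open Scope classical_set_scope.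
Local Open Scope ring_scope.

(** Write [G_k = u_t + H(z, grad u)] for [u = u_k], [I_k] for the minimal value of
    the functional, [m_k = exp (k G_k) / I_k], [h_k = ln I_k / k], and [S_k] for the
    integral of [m_k ln m_k].  For the mechanical Hamiltonian the Lagrangian is
    [L(z, v) = |v|^2 / 2 - eta . v - V].

    Energy balance.  On the graph measure equality holds in Fenchel-Young, and
    [ln m_k = k G_k - ln I_k].  Together with the Euler-Lagrange equation tested
    with [u_k] itself this gives ([graph_energy])
      action of [mu_k] + S_k / k = - h_k,   and [S_k >= 0].

    Upper bound for [- h_k].  Let [nu] be admissible with finite action.  If [nu]
    had a density of finite entropy, the Gibbs variational principle and
    Fenchel-Young would give [- h_k <= action of nu + entropy / k].  A general [nu] is
    handled by moving the function rather than the measure: the constraint is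
    tested with a translate of [u_k] by some [h] of size at most [1 / k], chosen so
    that the integral of [exp (k G_k (z + h))] against [nu] is at most
    [2 k^(d+1) I_k] ([averaged_translate], [minimizer_lower_bound]).  The loss is of
    order [ln k / k], and the action of the translated Lagrangian tends to that of
    [nu] by dominated convergence.  Hence the upper limit of [- h_k] is at most the
    action of every admissible measure ([eventually_le_action]).

    Limit.  Taking [nu = mu_1] bounds the actions, hence the second moments, of the
    [mu_k].  So the weak limit [mu] is admissible ([weak_cvg_admissible]) and its
    action is at most the lower limit of the actions of [mu_(k_j)]
    ([weak_cvg_lsc]).  As the latter are at most [- h_(k_j)], the action of [mu] is
    at most that of any admissible [nu]: this is (a).  With [nu = mu] the actions
    and [- h_(k_j)] are squeezed to the same limit, so their difference
    [S_(k_j) / k_j] tends to zero.  The relaxed entropy of [mu_(k_j)] lies between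
    0 and [S_(k_j)] ([entropy_ge0], [graph_entropy_le]), which is (b). *)

(** * Measurability of continuous functions *)

Section discretization.
Context (R : realType).

(** A sequence of maps with countable range and measurable fibres.  It encodes
    separability without reference to a topology, so that it passes to product
    sigma-algebras at once. *)
Definition discretization d (T : measurableType d) (q : nat -> T -> T) :=
  forall n, exists (C : countType) (c : T -> C) (s : C -> T),
    (forall x, q n x = s (c x)) /\ forall a, measurable (c @^-1` [set a]).

(** Why a continuous [f] on a product of Euclidean spaces is measurable for the
    product sigma-algebra: it is the pointwise limit of the functions [f \o q n],
    each of which is constant on countably many measurable cells. *)
Lemma measurable_discretized d (T : measurableType d) (q : nat -> T -> T)
    (f : T -> R) : discretization q ->
  (forall x, f (q n x) @[n --> \oo] --> f x) -> measurable_fun setT f.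
Proof.
move=> dq qf; apply: (measurable_fun_cvg (h := fun n x => f (q n x))) => [n|x _].
  have [C [c [s [qE mc]]]] := dq n.
  move=> _ Y _; rewrite setTI.
  rewrite (_ : _ @^-1` Y =
      \bigcup_(a : C) (if `[< Y (f (s a)) >] then c @^-1` [set a] else set0)).
    by apply: countable_bigcupT_measurable => // a; case: ifP.
  apply/seteqP; split => [x /= Yx|x [a _]].
    by exists (c x) => //; rewrite asboolT// -qE.
  by case: asboolP => //= Ya cx; rewrite qE cx.
exact: qf.
Qed.

Lemma discretization_pair d1 d2 (T1 : measurableType d1)
    (T2 : measurableType d2) (q1 : nat -> T1 -> T1) (q2 : nat -> T2 -> T2) :
  discretization q1 -> discretization q2 ->
  discretization (fun n (x : T1 * T2) => (q1 n x.1, q2 n x.2)).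
Proof.
move=> dq1 dq2 n; have [C1 [c1 [s1 [q1E mc1]]]] := dq1 n.
have [C2 [c2 [s2 [q2E mc2]]]] := dq2 n.
exists (C1 * C2)%type, (fun x => (c1 x.1, c2 x.2)), (fun a => (s1 a.1, s2 a.2)).
split=> [x|[a1 a2]]; first by rewrite q1E q2E.
rewrite (_ : _ @^-1` _ = (c1 @^-1` [set a1]) `*` (c2 @^-1` [set a2])).
  exact: measurableX.
by apply/seteqP; split => x /= [-> ->].
Qed.

Definition grid (n : nat) (x : R) : R := (Num.floor (n.+1%:R * x))%:~R / n.+1%:R.

Definition row_grid k (n : nat) (x : 'rV[R]_k) : 'rV[R]_k :=
  \row_i grid n (x ord0 i).

Lemma grid_dist n x : `|x - grid n x| <= n.+1%:R^-1.
Proof.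
rewrite /grid; have n0 : (0 : R) < n.+1%:R by rewrite ltr0n.
have -> : x - (Num.floor (n.+1%:R * x))%:~R / n.+1%:R =
    (n.+1%:R * x - (Num.floor (n.+1%:R * x))%:~R) * n.+1%:R^-1.
  by field; rewrite nat1r gt_eqF.
rewrite normrM (@gtr0_norm _ n.+1%:R^-1) ?invr_gt0//.
rewrite ler_piMl ?invr_ge0// ler_norml.
have := floor_le (n.+1%:R * x); have := floorD1_gt (n.+1%:R * x).
by rewrite intrD => h1 h2; apply/andP; split; lra.
Qed.

Lemma cvg_grid x : grid n x @[n --> \oo] --> x.
Proof.
apply/cvgrPdist_le => e e0.
have [N _ HN] := near_infty_natSinv_lt (PosNum e0).
exists N => // n /HN /= h; exact: le_trans (grid_dist n x) (ltW h).
Qed.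

Lemma cvg_row_grid k (x : 'rV[R]_k) : row_grid n x @[n --> \oo] --> x.
Proof.
apply/cvgrPdist_lt => e e0.
have [N _ HN] := near_infty_natSinv_lt (PosNum e0).
exists N => // n /HN /= h.
rewrite [ltLHS]/Num.norm/= mx_normrE; apply/bigmax_ltP; split=> // -[i j] _ /=.
by rewrite !mxE (ord1 i); exact: le_lt_trans (grid_dist n _) h.
Qed.

Lemma measurable_floor_fiber n (a : int) :
  measurable ((fun x : R => Num.floor (n.+1%:R * x)) @^-1` [set a]).
Proof.
rewrite (_ : _ @^-1` _ = (fun x : R => n.+1%:R * x) @^-1` `[a%:~R, (a + 1)%:~R[).
  by rewrite -[X in measurable X]setTI; exact: measurable_funM.
apply/seteqP; split=> x /=; rewrite in_itv/=.
  by move=> <-; rewrite floor_le floorD1_gt.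
by move=> h; apply: floor_def.
Qed.

Lemma discretization_grid : discretization (fun n (x : R) => grid n x).
Proof.
move=> n; exists int, (fun x => Num.floor (n.+1%:R * x)), (fun a => a%:~R / n.+1%:R).
by split=> // a; exact: measurable_floor_fiber.
Qed.

Lemma discretization_row_grid k :
  discretization (fun n (x : 'rV[R]_k) => row_grid n x).
Proof.
move=> n; exists 'rV[int]_k,
  (fun x : 'rV[R]_k => \row_i Num.floor (n.+1%:R * x ord0 i)),
  (fun a : 'rV[int]_k => \row_i ((a ord0 i)%:~R / n.+1%:R)).
split=> [x|a]; first by apply/rowP => i; rewrite !mxE.
rewrite (_ : _ @^-1` _ = \bigcap_(i in [set: 'I_k])
  ((fun x : 'rV[R]_k => x ord0 i) @^-1`
   ((fun x : R => Num.floor (n.+1%:R * x)) @^-1` [set a ord0 i]))).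
  apply: fin_bigcap_measurable => // i _.
  rewrite -[X in measurable X]setTI; apply: measurable_coord => //.
  exact: measurable_floor_fiber.
apply/seteqP; split=> x /=.
  by move=> <- i _ /=; rewrite mxE.
by move=> h; apply/rowP => i; rewrite mxE; exact: h.
Qed.

Lemma cvgn_pair (U V : topologicalType) (a : nat -> U) (b : nat -> V)
    (x : U) (y : V) :
  a n @[n --> \oo] --> x -> b n @[n --> \oo] --> y ->
  (fun n => (a n, b n)) @ \oo --> (x, y).
Proof. by move=> ax bya; exact: cvg_pair. Qed.

Definition spacetime_grid k (n : nat) (z : spacetime R k) : spacetime R k :=
  (row_grid n z.1, grid n z.2).

Definition phase_grid k (n : nat) (w : phase R k) : phase R k :=
  (spacetime_grid n w.1, row_grid n w.2).

Lemma discretization_spacetime_grid k :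
  discretization (fun n (z : spacetime R k) => spacetime_grid n z).
Proof. exact: discretization_pair (@discretization_row_grid k) discretization_grid. Qed.

Lemma discretization_phase_grid k :
  discretization (fun n (w : phase R k) => phase_grid n w).
Proof.
exact: discretization_pair (@discretization_spacetime_grid k)
  (@discretization_row_grid k).
Qed.

Lemma cvg_spacetime_grid k (z : spacetime R k) :
  (fun n => spacetime_grid n z) @ \oo --> z.
Proof. by case: z => x t; exact: cvgn_pair (@cvg_row_grid _ x) (@cvg_grid t). Qed.

Lemma cvg_phase_grid k (w : phase R k) : (fun n => phase_grid n w) @ \oo --> w.
Proof.
by case: w => z v; exact: cvgn_pair (@cvg_spacetime_grid _ z) (@cvg_row_grid _ v).
Qed.

Lemma measurable_continuous_spacetime k (f : spacetime R k -> R) :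
  continuous f -> measurable_fun setT f.
Proof.
move=> cf; apply: (measurable_discretized (@discretization_spacetime_grid k)) => z.
exact: (cvg_comp _ f (@cvg_spacetime_grid k z) (cf z)).
Qed.

Lemma measurable_continuous_phase k (f : phase R k -> R) :
  continuous f -> measurable_fun setT f.
Proof.
move=> cf; apply: (measurable_discretized (@discretization_phase_grid k)) => w.
exact: (cvg_comp _ f (@cvg_phase_grid k w) (cf w)).
Qed.

Lemma measurable_continuous_phase_spacetime k
    (f : phase R k * spacetime R k -> R) :
  continuous f -> measurable_fun setT f.
Proof.
move=> cf; apply: (measurable_discretized (discretization_pair
  (@discretization_phase_grid k) (@discretization_spacetime_grid k))) => -[w z].
exact: (cvg_comp _ f (cvgn_pair (@cvg_phase_grid k w) (@cvg_spacetime_grid k z))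
  (cf (w, z))).
Qed.

End discretization.

(** * Euclidean algebra and periodic functions *)

Section euclidean.
Context (R : realType) (d : nat).
Implicit Types p q v w : 'rV[R]_d.

Lemma dotC p q : dot p q = dot q p.
Proof. by apply: eq_bigr => i _; rewrite mulrC. Qed.

Lemma dotDl p q v : dot (p + q) v = dot p v + dot q v.
Proof. by rewrite -big_split; apply: eq_bigr => i _; rewrite mxE mulrDl. Qed.

Lemma dotZl (a : R) p v : dot (a *: p) v = a * dot p v.
Proof. by rewrite mulr_sumr; apply: eq_bigr => i _; rewrite mxE mulrA. Qed.

Lemma dotDr p q v : dot v (p + q) = dot v p + dot v q.
Proof. by rewrite !(dotC v) dotDl. Qed.

Lemma dotZr (a : R) p v : dot v (a *: p) = a * dot v p.
Proof. by rewrite !(dotC v) dotZl. Qed.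

Lemma dotNl p v : dot (- p) v = - dot p v.
Proof. by rewrite -scaleN1r dotZl mulN1r. Qed.

Lemma dotNr p v : dot v (- p) = - dot v p.
Proof. by rewrite !(dotC v) dotNl. Qed.

Lemma dot_ge0 p : 0 <= dot p p.
Proof. by apply: sumr_ge0 => i _; rewrite -expr2 sqr_ge0. Qed.

Lemma enorm_ge0 p : 0 <= enorm p.
Proof. exact: sqrtr_ge0. Qed.

Lemma enorm_sqr p : enorm p ^+ 2 = dot p p.
Proof. by rewrite sqr_sqrtr// dot_ge0. Qed.

(** Weighted Young inequality, from the square of [e v - p / 2]. *)
Lemma young (e : R) p v : 0 < e ->
  dot p v <= e * dot v v + (4 * e)^-1 * dot p p.
Proof.
move=> e0; have := dot_ge0 (e *: v - 2^-1 *: p).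
rewrite !dotDl !dotDr !(dotNl, dotNr) !(dotZl, dotZr) (dotC v p) => h.
have : 0 <= e^-1 * (e * e * dot v v - e * dot p v + 4^-1 * dot p p).
  by apply: mulr_ge0; [rewrite invr_ge0 ltW|lra].
have -> : e^-1 * (e * e * dot v v - e * dot p v + 4^-1 * dot p p) =
   e * dot v v + (4 * e)^-1 * dot p p - dot p v by field; rewrite gt_eqF.
by rewrite subr_ge0.
Qed.

Lemma norm_dot_le p v (e : R) : 0 < e ->
  `|dot p v| <= e * dot v v + (4 * e)^-1 * dot p p.
Proof.
move=> e0; rewrite ler_norml young// andbT.
have := young (- p) v e0; rewrite !dotNl dotNr opprK; lra.
Qed.

End euclidean.

Section continuity.
Context (R : realType) (T : topologicalType) (d : nat).

Lemma continuous_entry (f : T -> 'rV[R]_d) i :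
  continuous f -> continuous (fun x => f x ord0 i).
Proof.
by move=> cf x; apply: (cvg_comp f (fun M : 'rV[R]_d => M ord0 i) (cf x));
  exact: coord_continuous.
Qed.

Lemma continuous_row (f : T -> 'rV[R]_d) :
  (forall i, continuous (fun x => f x ord0 i)) -> continuous f.
Proof.
move=> cf x; apply/cvgrPdist_lt => e e0.
have : \forall y \near x, forall i : 'I_d, `|f x ord0 i - f y ord0 i| < e.
  apply: filter_forall => i; have /cvgrPdist_lt := cf i x; exact.
apply: filterS => y fy.
rewrite [ltLHS]/Num.norm/= mx_normrE; apply/bigmax_ltP; split=> // -[i j] _ /=.
by rewrite !mxE (ord1 i).
Qed.

Lemma continuous_sumr (I : Type) (r : seq I) (f : I -> T -> R) :
  (forall i, continuous (f i)) -> continuous (fun x => \sum_(i <- r) f i x).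
Proof.
move=> cf; elim: r => [|i r IH].
  have -> : (fun x => \sum_(i <- [::]) f i x) = (fun=> 0).
    by apply/funext => x; rewrite big_nil.
  by move=> x; exact: cvg_cst.
have -> : (fun x => \sum_(j <- i :: r) f j x) =
    (fun x => f i x + \sum_(j <- r) f j x).
  by apply/funext => x; rewrite big_cons.
by move=> x; apply: cvgD; [exact: cf|exact: IH].
Qed.

Lemma continuous_dot (f g : T -> 'rV[R]_d) :
  continuous f -> continuous g -> continuous (fun x => dot (f x) (g x)).
Proof.
move=> cf cg; apply: continuous_sumr => i x.
by apply: cvgM; apply: continuous_entry.
Qed.

Lemma continuous_pair (S U W : topologicalType) (f : S -> U) (g : S -> W) :
  continuous f -> continuous g -> continuous (fun x => (f x, g x)).
Proof. by move=> cf cg x; apply: cvg_pair; [exact: cf|exact: cg]. Qed.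

End continuity.

Section periodic.
Context (R : realType) (d : nat).
Implicit Type f : spacetime R d -> R.

Lemma periodicz (U W : zmodType) (f : U -> W) (T : U) (m : int) x :
  periodic f T -> f (x + T *~ m) = f x.
Proof.
move=> fT; case: m => n; first by rewrite -pmulrn (periodicn fT).
by rewrite NegzE mulrNz -pmulrn -[LHS](periodicn fT n.+1) subrK.
Qed.

Lemma periodic_space f (m : 'I_d -> int) x t : torus_periodic f ->
  f (x + \row_i (m i)%:~R, t) = f (x, t).
Proof.
move=> [fx _].
have -> : (\row_i (m i)%:~R : 'rV[R]_d) =
    \sum_(i <- enum 'I_d) (delta_mx ord0 i *~ m i : 'rV[R]_d).
  apply/rowP => j; rewrite !mxE summxE big_enum/=.
  have e i : ((delta_mx ord0 i : 'rV[R]_d) *~ m i) ord0 j =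
      (m i)%:~R * (j == i)%:R.
    by rewrite -(scaler_int _ (delta_mx ord0 i)) !mxE eqxx.
  rewrite (bigD1 j)//= e eqxx mulr1 big1 ?addr0// => i ij.
  by rewrite e eq_sym (negbTE ij) mulr0.
elim: (enum 'I_d) x => [|i r IH] x; first by rewrite big_nil addr0.
rewrite big_cons addrA IH.
have := @periodicz (spacetime R d) R f (delta_mx ord0 i, 0) (m i) (x, t) (fx i).
have pairz (n : int) : ((delta_mx ord0 i, 0) : spacetime R d) *~ n =
    (delta_mx ord0 i *~ n, 0).
  case: n => n; rewrite ?NegzE ?mulrNz -!pmulrn.
    elim: n => [//|n IHn]; rewrite !mulrS IHn.
    by apply/pair_eqP; rewrite /= addr0 !eqxx.
  elim: n => [|n IHn]; first by apply/pair_eqP; rewrite /= !mulr1n oppr0 !eqxx.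
  rewrite !(mulrS _ n.+1) !opprD IHn.
  by apply/pair_eqP; rewrite /= oppr0 addr0 !eqxx.
rewrite pairz => <-; congr f; apply/pair_eqP.
by rewrite /= addr0 !eqxx.
Qed.

Lemma periodic_time f (m : int) x t : torus_periodic f ->
  f (x, t + m%:~R) = f (x, t).
Proof.
move=> [_ ft]; have := @periodicz R R (fun t => f (x, t)) 1 m t.
apply => s; have := ft (x, s) => <-; congr f; apply/pair_eqP.
by rewrite /= addr0 !eqxx.
Qed.

(** Subtracting the integer parts of the coordinates moves any point into the
    compact cube without changing the value of the function. *)
Lemma bounded_periodic f : continuous f -> torus_periodic f ->
  exists M, forall z, `|f z| <= M.
Proof.
move=> cf pf.
pose K : set (spacetime R d) :=
  [set v : 'rV[R]_d | forall i, `[0, 1]%classic (v ord0 i)] `*` `[0, 1]%classic.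
have cK : compact K.
  apply: compact_setX; last exact: segment_compact.
  exact: (@rV_compact R d (fun=> `[0, 1]%classic) (fun=> @segment_compact R 0 1)).
have /compact_bounded/pinfty_ex_gt0[M M0 HM] : compact (f @` K).
  by apply: continuous_compact => //; exact: continuous_subspaceT.
exists M => -[x t].
have fl (a : R) : 0 <= a - (Num.floor a)%:~R <= 1.
  by have := floor_le a; have := floorD1_gt a; rewrite intrD; lra.
have -> : f (x, t) = f (x + \row_i (- Num.floor (x ord0 i))%:~R,
    t + (- Num.floor t)%:~R).
  by rewrite periodic_space// periodic_time.
apply: HM; eexists; last reflexivity; split=> [i|] /=.
  by rewrite !mxE mulrNz in_itv/= fl.
by rewrite mulrNz in_itv/= fl.
Qed.

End periodic.

(** * Test functions and the mechanical Hamiltonian *)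

Section test_functions.
Context (R : realType) (d : nat).
Implicit Types f g : spacetime R d -> R.

Lemma derive_translate (U W : normedModType R) (f : U -> W) (h v z : U) :
  'D_v (fun y => f (y + h)) z = 'D_v f (z + h).
Proof.
rewrite /derive [X in X @ _](_ : _ =
  (fun e : R => e^-1 *: ((f \o shift (z + h)) (e *: v) - f (z + h))))//.
by apply/funext => e /=; rewrite addrA.
Qed.

Lemma differentiable_translate (U W : normedModType R) (f : U -> W) (h z : U) :
  differentiable f (z + h) -> differentiable (fun y => f (y + h)) z.
Proof.
move=> df; have dh : differentiable ((id : U -> U) + cst h) z.
  exact: differentiableD.
exact: (differentiable_comp dh df).
Qed.

Lemma Ck1_translate f h : Ck 1 f -> Ck 1 (fun z => f (z + h)).
Proof.
move=> [df cf]; split=> [z|v].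
  exact: differentiable_translate.
have -> : (fun z => 'D_v (fun y => f (y + h)) z) = (fun z => 'D_v f (z + h)).
  by apply/funext => z; rewrite derive_translate.
move=> z; apply: (@continuous_comp _ _ _ (fun z => z + h) ('D_v f)).
  by apply: cvgD; [exact: cvg_id|exact: cvg_cst].
exact: cf.
Qed.

Lemma dt_translate f h z : dt (fun y => f (y + h)) z = dt f (z + h).
Proof. exact: derive_translate. Qed.

Lemma grad_translate f h z : grad (fun y => f (y + h)) z = grad f (z + h).
Proof. by apply/rowP => i; rewrite !mxE derive_translate. Qed.

Lemma torus_periodic_translate f h :
  torus_periodic f -> torus_periodic (fun z => f (z + h)).
Proof.
move=> [fx ft]; split=> [i|] z; rewrite addrAC.
  exact: fx.
exact: ft.
Qed.

Lemma torus_periodic_derive f v :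
  torus_periodic f -> torus_periodic ('D_v f).
Proof.
move=> [fx ft]; split=> [i|] z; rewrite -derive_translate; congr ('D_v _ z).
  by apply/funext => y; exact: fx.
by apply/funext => y; exact: ft.
Qed.

Lemma Ck1_dt f : Ck 1 f -> continuous (dt f).
Proof. by move=> [_ cf]; exact: cf. Qed.

Lemma Ck1_grad f : Ck 1 f -> continuous (grad f).
Proof.
move=> [_ cf]; apply: continuous_row => i.
have -> : (fun z => grad f z ord0 i) =
    'D_((delta_mx ord0 i, 0) : spacetime R d) f.
  by apply/funext => z; rewrite mxE.
exact: cf.
Qed.

Lemma torus_periodic_dt f : torus_periodic f -> torus_periodic (dt f).
Proof. exact: torus_periodic_derive. Qed.

Lemma periodic_grad f : torus_periodic f ->
  (forall i, periodic (grad f) (delta_mx ord0 i, 0)) /\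
  periodic (grad f) (0, 1).
Proof.
move=> pf; split=> [j|] z; apply/rowP => i; rewrite !mxE.
  by have [+ _] := torus_periodic_derive (delta_mx ord0 i, 0) pf; apply.
by have [_] := torus_periodic_derive (delta_mx ord0 i, 0) pf; apply.
Qed.

Lemma derive_perturb f g (s : R) v z : Ck 1 f -> Ck 1 g ->
  'D_v (fun y => f y + s * g y) z = 'D_v f z + s * 'D_v g z.
Proof.
move=> [df _] [dg _].
rewrite (deriveD (g := s \*: g)); last 2 first.
- exact: diff_derivable.
- by apply: derivableZ; exact: diff_derivable.
by rewrite deriveZ//; exact: diff_derivable.
Qed.

Lemma Ck1_perturb f g (s : R) : Ck 1 f -> Ck 1 g ->
  Ck 1 (fun y => f y + s * g y).
Proof.
move=> Cf Cg; have [df cf] := Cf; have [dg cg] := Cg; split=> [z|v].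
  by apply: (differentiableD (g := s \*: g)) => //; exact: differentiableZ.
have -> : (fun z => 'D_v (fun y => f y + s * g y) z) =
    (fun z => 'D_v f z + s * 'D_v g z).
  by apply/funext => z; rewrite derive_perturb.
move=> z; apply: cvgD; first exact: cf.
by apply: cvgM; [exact: cvg_cst|exact: cg].
Qed.

Lemma dt_perturb f g (s : R) z : Ck 1 f -> Ck 1 g ->
  dt (fun y => f y + s * g y) z = dt f z + s * dt g z.
Proof. exact: derive_perturb. Qed.

Lemma grad_perturb f g (s : R) z : Ck 1 f -> Ck 1 g ->
  grad (fun y => f y + s * g y) z = grad f z + s *: grad g z.
Proof. by move=> Cf Cg; apply/rowP => i; rewrite !mxE derive_perturb. Qed.

Lemma torus_periodic_perturb f g (s : R) : torus_periodic f ->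
  torus_periodic g -> torus_periodic (fun y => f y + s * g y).
Proof.
by move=> [fx ft] [gx gt]; split=> [i|] z; rewrite ?fx ?gx ?ft ?gt.
Qed.

End test_functions.

Section mechanical.
Context (R : realType) (d : nat) (eta : R -> 'rV[R]_d) (V : spacetime R d -> R).
Let H := mechanical_hamiltonian eta V.

(** The Legendre transform of the mechanical Hamiltonian, in closed form. *)
Definition lagrangian (z : spacetime R d) (v : 'rV[R]_d) : R :=
  2^-1 * dot v v - dot (eta z.2) v - V z.

Lemma hamiltonianE z p :
  H z p = 2^-1 * dot (p + eta z.2) (p + eta z.2) + V z.
Proof. by rewrite /H /mechanical_hamiltonian enorm_sqr. Qed.

(** The defect is half the square of [v - (p + eta)]. *)
Lemma fenchel_young z p v : dot p v <= H z p + lagrangian z v.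
Proof.
have := dot_ge0 (v - (p + eta z.2)).
rewrite hamiltonianE /lagrangian.
rewrite !dotDl !dotDr !(dotNl, dotNr) !dotDl !dotDr.
rewrite (dotC v p) (dotC v (eta _)) (dotC (eta _) p).
lra.
Qed.

Lemma fenchel_young_eq z p :
  dot p (p + eta z.2) = H z p + lagrangian z (p + eta z.2).
Proof.
rewrite hamiltonianE /lagrangian !dotDl !dotDr (dotC (eta _) p).
lra.
Qed.

Lemma legendre_mechanical z v : legendre H z v = (lagrangian z v)%:E.
Proof.
apply/eqP; rewrite eq_le; apply/andP; split.
  apply: ub_ereal_sup => _ [p _ <-]; rewrite lee_fin.
  by have := fenchel_young z p v; lra.
apply: ereal_sup_ubound; exists (v - eta z.2) => //; congr EFin.
have := fenchel_young_eq z (v - eta z.2); rewrite subrK; lra.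
Qed.

Lemma grad_p_mechanical z p : grad_p H z p = p + eta z.2.
Proof.
apply/rowP => i; rewrite !mxE; apply/cvg_lim => //=.
set e := delta_mx ord0 i; set q := p + eta z.2.
have dote q' : dot e q' = q' ord0 i.
  rewrite /dot (bigD1 i)//= /e !mxE !eqxx mul1r big1 ?addr0// => j ji.
  by rewrite !mxE (negbTE ji) andbF mul0r.
have quad h q' : dot (h *: e + q') (h *: e + q') =
    h * h + 2 * h * q' ord0 i + dot q' q'.
  rewrite dotDl !dotDr !(dotZl, dotZr) (dotC q' e) !dote.
  rewrite (_ : e ord0 i = 1); last by rewrite mxE !eqxx.
  ring.
apply: (@cvg_trans _ ((fun h : R => q ord0 i + 2^-1 * h) @ 0^')).
  apply: near_eq_cvg; near=> h.
  have h0 : h != 0 by near: h; exact: nbhs_dnbhs_neq.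
  rewrite /= !hamiltonianE -!addrA -/q.
  by rewrite quad /GRing.scale/=; field.
have -> : p 0 i + eta z.2 0 i = q ord0 i + 2^-1 * 0.
  by rewrite mulr0 addr0 !mxE.
apply: cvgD; first exact: cvg_cst.
by apply: cvgM; [exact: cvg_cst|exact: cvg_within].
Unshelve. all: by end_near. Qed.

End mechanical.

(** * Rescaled translates of Lebesgue measure on the torus *)

Section line.
Context (R : realType).
Local Notation mu := (@lebesgue_measure R).
Local Open Scope ereal_scope.

Definition affine (s e : R) (x : measurableTypeR R) : measurableTypeR R :=
  (s + e * x)%R.

Lemma measurable_affine s e : measurable_fun setT (affine s e).
Proof.
apply: measurable_funD; first exact: measurable_cst.
by apply: measurable_funM; [exact: measurable_cst|exact: measurable_id].
Qed.

Definition affine_image s e : {measure set (measurableTypeR R) -> \bar R} :=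
  measure_function_pushforward__canonical__measure_function_Measure mu
    (measurable_affine s e).

(** The image of Lebesgue measure under [x -> s + e x], multiplied by [e], has the
    same value as Lebesgue measure on every interval. *)
Lemma integral_affine (f : measurableTypeR R -> \bar R) s (e : R) (e0 : (0 < e)%R) :
  measurable_fun setT f -> (forall x, 0 <= f x) ->
  \int[mu]_x f (s + e * x)%R = e^-1%:E * \int[mu]_x f x.
Proof.
move=> mf f0.
have e0' : (0 <= e)%R by exact: ltW.
have muE A : measurable A ->
    mu A = mscale (NngNum e0') (affine_image s e) A.
  move=> mA; apply: lebesgue_measure_unique => // _ [[a b] _ <-] /=.
  rewrite /mscale/=.
  have aE : affine s e @^-1` `]a, b]%classic =
      `]((a - s) / e)%R, ((b - s) / e)%R]%classic.
    apply/seteqP; split => x /=; rewrite !in_itv/= /affine => /andP[h1 h2].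
      rewrite ltr_pdivrMr// ler_pdivlMr//; apply/andP; split; lra.
    by move: h1 h2; rewrite ltr_pdivrMr// ler_pdivlMr// => h1 h2;
       apply/andP; split; lra.
  rewrite /pushforward aE.
  rewrite !lebesgue_measure_itv/= !lte_fin ltr_pM2r ?invr_gt0// ltrD2r.
  case: ifP => _; last by rewrite mule0.
  by rewrite -!EFinB -EFinM; congr EFin; field; rewrite gt_eqF.
have -> : \int[mu]_x f x =
    \int[mscale (NngNum e0') (affine_image s e)]_x f x.
  by apply: eq_measure_integral => A mA _; exact: muE.
rewrite ge0_integral_mscale// ge0_integral_pushforward//=;
  last exact: measurable_affine.
by rewrite muleA -EFinM mulVf ?gt_eqF// mul1e.
Qed.

Lemma integral_affine_itv (f : measurableTypeR R -> \bar R) s (e a b : R)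
    (e0 : (0 < e)%R) : measurable_fun setT f -> (forall x, 0 <= f x) ->
  \int[mu]_(x in `[a, b[) f (s + e * x)%R =
  e^-1%:E * \int[mu]_(x in `[(s + e * a)%R, (s + e * b)%R[) f x.
Proof.
move=> mf f0; rewrite [in LHS]integral_mkcond [in RHS]integral_mkcond.
rewrite -(integral_affine s e0); last 2 first.
- by apply: (measurable_restrictT f _).1; [exact: measurable_itv|exact: measurable_funTS].
- by move=> x; rewrite patchE; case: ifP.
apply: eq_integral => x _; rewrite !patchE.
suff -> : (x \in `[a, b[%classic) =
  ((s + e * x)%R \in `[(s + e * a)%R, (s + e * b)%R[%classic) by [].
apply/idP/idP; rewrite !inE/= !in_itv/= => /andP[h1 h2].
  by rewrite lerD2l ltrD2l ler_pM2l// ltr_pM2l// h1.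
by move: h1 h2; rewrite lerD2l ltrD2l ler_pM2l// ltr_pM2l// => -> ->.
Qed.

Lemma ge0_integral_itv_split (f : measurableTypeR R -> \bar R) (a b c : R) :
  (a <= b <= c)%R -> measurable_fun setT f -> (forall x, 0 <= f x) ->
  \int[mu]_(x in `[a, c[) f x =
  \int[mu]_(x in `[a, b[) f x + \int[mu]_(x in `[b, c[) f x.
Proof.
move=> /andP[ab bc] mf f0.
rewrite (@itv_bndbnd_setU _ _ _ (BLeft b)) ?bnd_simp//.
rewrite ge0_integral_setU//=.
- exact: measurable_funTS.
- apply/disj_setPS => x [] /=; rewrite !in_itv/= => /andP[_ xb] /andP[bx _].
  by move: xb; rewrite ltNge bx.
Qed.

Lemma integral_period (f : measurableTypeR R -> \bar R) (s : R) :
  measurable_fun setT f -> (forall x, 0 <= f x) ->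
  (forall x, f (x + 1)%R = f x) ->
  \int[mu]_(x in `[s, (s + 1)%R[) f x = \int[mu]_(x in `[0%R, 1%R[) f x.
Proof.
move=> mf f0 fp.
have fz (m : int) x : f (m%:~R + 1 * x)%R = f x.
  rewrite mul1r addrC; case: m => n.
    elim: n x => [|n IH] x; first by rewrite addr0.
    by rewrite -pmulrn -addn1 natrD addrA fp IH.
  rewrite NegzE mulrNz -[RHS](_ : f (x - n.+1%:~R + n.+1%:R)%R = _); last first.
    by rewrite -pmulrn subrK.
  elim: n.+1 (x - _)%R => [|k IH] y; first by rewrite addr0.
  by rewrite -addn1 natrD addrA fp IH.
(* Shift by the integer part of [s], then cut the window at 1. *)
pose n := Num.floor s; pose r := (s - n%:~R)%R.
have r01 : (0 <= r <= 1)%R.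
  rewrite /r /n; have := floor_le s; have := floorD1_gt s; rewrite intrD; lra.
have -> : \int[mu]_(x in `[s, (s + 1)%R[) f x = \int[mu]_(x in `[r, (r + 1)%R[) f x.
  have := @integral_affine_itv f n%:~R 1%R r (r + 1)%R ltr01 mf f0.
  have -> : (n%:~R + 1 * r = s)%R by rewrite /r; ring.
  have -> : (n%:~R + 1 * (r + 1) = s + 1)%R by rewrite /r; ring.
  rewrite invr1 mul1e => <-.
  by apply: eq_integral => x _; rewrite fz.
rewrite (@ge0_integral_itv_split f r 1%R (r + 1)%R)//; last by lra.
rewrite (@ge0_integral_itv_split f 0%R r 1%R)// addeC; congr (_ + _).
have := @integral_affine_itv f 1%R 1%R 0%R r ltr01 mf f0.
rewrite invr1 mul1e mulr0 addr0 mul1r (addrC 1%R) => <-.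
by apply: eq_integral => x _; rewrite mul1r addrC fp.
Qed.

(** The point [s + e x] ranges over an interval of length [e], which lies inside a
    single period; the price of zooming in is the Jacobian [e^-1]. *)
Lemma integral_rescale_le (f : measurableTypeR R -> \bar R) (s e : R) :
  (0 < e <= 1)%R -> measurable_fun setT f -> (forall x, 0 <= f x) ->
  (forall x, f (x + 1)%R = f x) ->
  \int[mu]_(x in `[0%R, 1%R[) f (s + e * x)%R <=
  e^-1%:E * \int[mu]_(x in `[0%R, 1%R[) f x.
Proof.
move=> /andP[e0 e1] mf f0 fp.
rewrite integral_affine_itv// mulr0 addr0 mulr1.
rewrite lee_pmul2l ?lte_fin ?invr_gt0//.
rewrite -(integral_period s)//; apply: ge0_subset_integral => //=.
  exact: measurable_funTS.
by apply: subset_itvl; rewrite bnd_simp lerD2l.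
Qed.

Lemma integral_lebesgue_unit (f : R -> \bar R) :
  measurable_fun setT f -> (forall x, 0 <= f x) ->
  \int[lebesgue_unit R]_x f x = \int[mu]_(x in `[0%R, 1%R[) f (to_R x).
Proof.
move=> mf f0; rewrite ge0_integral_distribution//.
have mf' : measurable_fun setT (f \o @to_R R).
  exact: measurableT_comp.
rewrite integral_uniform//= subr0 invr1 mul1e.
by rewrite -integral_itv_bndo_bndc//; exact: measurable_funTS.
Qed.

Lemma integral_unit_rescale_le (f : R -> \bar R) (s e : R) :
  (0 < e <= 1)%R -> measurable_fun setT f -> (forall x, 0 <= f x) ->
  (forall x, f (x + 1)%R = f x) ->
  \int[lebesgue_unit R]_x f (s + e * x)%R <=
  e^-1%:E * \int[lebesgue_unit R]_x f x.
Proof.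
move=> e01 mf f0 fp.
rewrite !integral_lebesgue_unit//; last first.
  by apply: measurableT_comp => //; exact: (measurable_affine s e).
apply: (@integral_rescale_le (f \o @to_R R)) => //.

Qed.

Lemma integral_unit_ge (f : R -> \bar R) (c : R) :
  measurable_fun setT f -> (forall x, 0 <= f x) ->
  (forall x, (0 <= x <= 1)%R -> c%:E <= f x) -> (0 <= c)%R ->
  c%:E <= \int[lebesgue_unit R]_x f x.
Proof.
move=> mf f0 fc c0; rewrite integral_lebesgue_unit//.
apply: (@le_trans _ _ (\int[mu]_(x in `[0%R, 1%R[) (cst c%:E) x)).
  by rewrite integral_cst//= lebesgue_measure_itv/= lte_fin ltr01 oppr0 adde0 mule1.
apply: ge0_le_integral => //=.
- apply: measurable_funTS; exact: measurableT_comp.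
- by move=> x; rewrite in_itv/= => /andP[x0 x1]; apply: fc; rewrite x0 ltW.
Qed.

End line.

Section cube.
Context (R : realType).
Local Open Scope ereal_scope.

Lemma ge0_integral_scale (d0 : measure_display) (T : measurableType d0)
    (P : probability T R) (g : T -> \bar R) (c : \bar R) : 0 <= c ->
  measurable_fun setT g -> (forall x, 0 <= g x) ->
  \int[P]_x (c * g x) = c * \int[P]_x g x.
Proof. by move=> c0 mg g0; rewrite ge0_integralZl. Qed.

Lemma integral_cubeS n (f : 'rV[R]_n.+1 -> \bar R) :
  measurable_fun setT f -> (forall x, 0 <= f x) ->
  \int[lebesgue_cube R n.+1]_x f x =
  \int[lebesgue_unit R]_a \int[lebesgue_cube R n]_x f (row_cons (a, x)).
Proof.
move=> mf f0; rewrite /= ge0_integral_distribution// fubini_tonelli1//=.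
by apply: measurableT_comp => //; exact: measurable_row_cons.
Qed.

Lemma measurable_row_affine n (x : 'rV[R]_n) (e : R) :
  measurable_fun setT (fun y : 'rV[R]_n => x + e *: y)%R.
Proof.
apply: measurable_fun_rV => i.
rewrite (_ : (fun y : 'rV[R]_n => (x + e *: y)%R ord0 i) =
  (fun y : 'rV[R]_n => x ord0 i + e * y ord0 i)%R); last first.
  by apply/funext => y; rewrite !mxE.
apply: measurable_funD; first exact: measurable_cst.
by apply: measurable_funM; [exact: measurable_cst|exact: measurable_coord].
Qed.

Lemma row_cons0 n (a : R) (y : 'rV[R]_n) : row_cons (a, y) ord0 ord0 = a.
Proof.
transitivity (row_mx (a%:M : 'rV[R]_1) y ord0 (lshift n ord0)).
  by rewrite /row_cons; congr (row_mx _ _ _ _); apply: val_inj.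
by rewrite row_mxEl mxE eqxx mulr1n.
Qed.

Lemma row_consS n (a : R) (y : 'rV[R]_n) i :
  row_cons (a, y) ord0 (lift ord0 i) = y ord0 i.
Proof.
transitivity (row_mx (a%:M : 'rV[R]_1) y ord0 (rshift 1 i)).
  by rewrite /row_cons; congr (row_mx _ _ _ _); apply: val_inj.
by rewrite row_mxEr.
Qed.

Lemma row_cons_surj n (x : 'rV[R]_n.+1) :
  exists a (y : 'rV[R]_n), x = row_cons (a, y).
Proof.
exists (x ord0 ord0), (\row_i x ord0 (lift ord0 i)); apply/rowP => j.
by case: (unliftP ord0 j) => [k|] ->; rewrite ?row_consS ?row_cons0 ?mxE.
Qed.

Lemma row_cons_affine n (a0 a e : R) (x y : 'rV[R]_n) :
  (row_cons (a0, x) + e *: row_cons (a, y))%R =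
  row_cons (a0 + e * a, x + e *: y)%R.
Proof.
apply/rowP => j; case: (unliftP ord0 j) => [k|] ->.
  rewrite [RHS]row_consS [LHS]mxE [RHS]mxE row_consS; congr (_ + _)%R.
  by rewrite [LHS]mxE row_consS [RHS]mxE.
rewrite [RHS]row_cons0 [LHS]mxE row_cons0; congr (_ + _)%R.
by rewrite [LHS]mxE row_cons0.
Qed.

Lemma row_cons_delta0 n (a : R) (x : 'rV[R]_n) :
  row_cons (a + 1, x)%R = (row_cons (a, x) + delta_mx ord0 ord0)%R.
Proof.
apply/rowP => j; case: (unliftP ord0 j) => [k|] ->.
  by rewrite [LHS]row_consS [RHS]mxE row_consS mxE andbC addr0.
by rewrite [LHS]row_cons0 [RHS]mxE row_cons0 mxE !eqxx.
Qed.

Lemma row_cons_delta n (a : R) (x : 'rV[R]_n) i :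
  row_cons (a, x + delta_mx ord0 i)%R =
  (row_cons (a, x) + delta_mx ord0 (lift ord0 i))%R.
Proof.
apply/rowP => j; case: (unliftP ord0 j) => [k|] ->.
  by rewrite [LHS]row_consS [LHS]mxE [RHS]mxE row_consS !mxE (inj_eq lift_inj).
by rewrite [LHS]row_cons0 [RHS]mxE row_cons0 mxE andbC addr0.
Qed.

(** One coordinate at a time, by Tonelli's theorem. *)
Lemma integral_cube_rescale_le n (f : 'rV[R]_n -> \bar R) (x : 'rV[R]_n) (e : R) :
  (0 < e <= 1)%R -> measurable_fun setT f -> (forall x, 0 <= f x) ->
  (forall i, forall x : 'rV[R]_n, f (x + delta_mx ord0 i)%R = f x) ->
  \int[lebesgue_cube R n]_y f (x + e *: y)%R <=
  (e ^- n)%:E * \int[lebesgue_cube R n]_y f y.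
Proof.
move=> e01; elim: n f x => [|n IH] f x mf f0 fp.
  rewrite expr0 invr1 mul1e le_eqVlt; apply/orP; left; apply/eqP.
  by apply: eq_integral => y _; congr f; apply/rowP => -[].
have [a0 [x' ->]] := row_cons_surj x.
have mfa : measurable_fun setT
    (fun y : 'rV[R]_n.+1 => f (row_cons (a0, x') + e *: y)%R).
  by apply: measurableT_comp => //; exact: measurable_row_affine.
have mc a : measurable_fun setT (fun y : 'rV[R]_n => f (row_cons (a, y))).
  apply: measurableT_comp => //; apply: (measurableT_comp (@measurable_row_cons R n)).
  exact: measurable_pair1.
pose g a := \int[lebesgue_cube R n]_y f (row_cons (a, y)).
have mg : measurable_fun setT g.
  apply: (@measurable_fun_fubini_tonelli_F _ _ _ _ _ (lebesgue_cube R n)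
    (fun ay : R * 'rV[R]_n => f (row_cons ay))) => //.
  by apply: measurableT_comp => //; exact: measurable_row_cons.
have g0 a : 0 <= g a by apply: integral_ge0.
have e0 : (0 < e)%R by case/andP: e01.
have c0 m : 0 <= (e ^- m)%:E by rewrite lee_fin invr_ge0 exprn_ge0// ltW.
rewrite !integral_cubeS//.
apply: (@le_trans _ _ (\int[lebesgue_unit R]_a ((e ^- n)%:E * g (a0 + e * a)%R))).
  apply: ge0_le_integral => //.
  - by move=> a _; apply: integral_ge0.
  - apply: (@measurable_fun_fubini_tonelli_F _ _ _ _ _ (lebesgue_cube R n)
      (fun ay : R * 'rV[R]_n => f (row_cons (a0, x') + e *: row_cons ay)%R)) => //.
    by apply: (measurableT_comp mfa); exact: measurable_row_cons.
  - apply: measurable_funeM; apply: (measurableT_comp mg).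
    exact: (measurable_affine a0 e).
  - move=> a _; under eq_integral do rewrite row_cons_affine.
    apply: (IH (fun y : 'rV[R]_n => f (row_cons ((a0 + e * a)%R, y)))) => // i y.
    by rewrite row_cons_delta fp.
have mga : measurable_fun setT (fun a => g (a0 + e * a)%R).
  by apply: (measurableT_comp mg); exact: (measurable_affine a0 e).
rewrite (@ge0_integral_scale _ _ (lebesgue_unit R) _ _ (c0 n) mga (fun=> g0 _)).
rewrite exprS invfM EFinM -muleA (muleCA (e^-1)%:E).
apply: lee_wpmul2l => //; apply: integral_unit_rescale_le => // a.
by apply: eq_integral => y _; rewrite row_cons_delta0 fp.
Qed.

(** The form in which the support of the measure enters the argument: only the
    values on the closed unit cube count. *)
Lemma integral_cube_ge n (f : 'rV[R]_n -> \bar R) (c : R) :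
  measurable_fun setT f -> (forall x, 0 <= f x) -> (0 <= c)%R ->
  (forall x : 'rV[R]_n, (forall i, 0 <= x ord0 i <= 1)%R -> c%:E <= f x) ->
  c%:E <= \int[lebesgue_cube R n]_x f x.
Proof.
move=> + + c0; elim: n f => [|n IH] f mf f0 fc.
  by rewrite /= integral_dirac// diracT mul1e; apply: fc => -[].
have mrc : measurable_fun setT (f \o @row_cons R n).
  by apply: measurableT_comp => //; exact: measurable_row_cons.
rewrite integral_cubeS//; apply: integral_unit_ge => //.
- apply: (@measurable_fun_fubini_tonelli_F _ _ _ _ _ (lebesgue_cube R n)
    (f \o @row_cons R n)) => //=.
- by move=> a; apply: integral_ge0.
- move=> a a01; apply: (IH (fun x : 'rV[R]_n => f (row_cons (a, x)))) => //.
    by apply: (measurableT_comp mrc); exact: measurable_pair1.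
  move=> x x01; apply: fc => i.
  by case: (unliftP ord0 i) => [k|] ->; rewrite ?row_consS ?row_cons0.
Qed.

End cube.

Section torus_integral.
Context (R : realType) (d : nat).
Local Open Scope ereal_scope.
Implicit Type f : spacetime R d -> \bar R.

Lemma integral_torus f : measurable_fun setT f -> (forall z, 0 <= f z) ->
  \int[lebesgue_torus d]_z f z =
  \int[lebesgue_cube R d]_x \int[lebesgue_unit R]_t f (x, t).
Proof. by move=> mf f0; rewrite /lebesgue_torus fubini_tonelli1. Qed.

(** Averaging a periodic function over the small cube of side [e] with corner [z]
    costs at most the factor [e ^- d.+1], uniformly in [z]. *)
Lemma integral_torus_rescale_le f z (e : R) :
  (0 < e <= 1)%R -> measurable_fun setT f -> (forall z, 0 <= f z) ->
  (forall i, forall (x : 'rV[R]_d) t, f (x + delta_mx ord0 i, t)%R = f (x, t)) ->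
  (forall (x : 'rV[R]_d) t, f (x, t + 1)%R = f (x, t)) ->
  \int[lebesgue_torus d]_y f (z + e *: y)%R <=
  (e ^- d.+1)%:E * \int[lebesgue_torus d]_y f y.
Proof.
case: z => x0 t0 e01 mf f0 fx ft.
have e0 : (0 < e)%R by case/andP: e01.
have c0 : 0 <= (e^-1)%:E by rewrite lee_fin invr_ge0 ltW.
pose g x := \int[lebesgue_unit R]_t f (x, t).
have mg : measurable_fun setT g.
  exact: (@measurable_fun_fubini_tonelli_F _ _ _ _ _ (lebesgue_unit R) f).
have g0 x : 0 <= g x by apply: integral_ge0.
have mfa : measurable_fun setT (fun y : spacetime R d => f ((x0, t0) + e *: y)%R).
  apply: (measurableT_comp mf (g := fun y : spacetime R d => ((x0, t0) + e *: y)%R)).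
  apply/measurable_fun_pairP; split.
    by apply: (measurableT_comp (measurable_row_affine x0 e)).
  by apply: (measurableT_comp (measurable_affine t0 e)).
rewrite !integral_torus//.
apply: (@le_trans _ _ (\int[lebesgue_cube R d]_x ((e^-1)%:E * g (x0 + e *: x)%R))).
  apply: ge0_le_integral => //.
  - by move=> a _; apply: integral_ge0.
  - exact: (@measurable_fun_fubini_tonelli_F _ _ _ _ _ (lebesgue_unit R)
      (fun y : spacetime R d => f ((x0, t0) + e *: y)%R)).
  - apply: measurable_funeM; apply: (measurableT_comp mg).
    exact: measurable_row_affine.
  - move=> x _.
    apply: (integral_unit_rescale_le (f := fun t => f ((x0 + e *: x)%R, t))) => //.
    by apply: (measurableT_comp mf); exact: measurable_pair1.
have mgx : measurable_fun setT (fun x : 'rV[R]_d => g (x0 + e *: x)%R).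
  by apply: (measurableT_comp mg); exact: measurable_row_affine.
rewrite (@ge0_integral_scale _ _ _ (lebesgue_cube R d) _ _ c0 mgx (fun=> g0 _)).
rewrite exprS invfM EFinM -muleA; apply: lee_wpmul2l => //.
apply: integral_cube_rescale_le => // i x.
by apply: eq_integral => t _; rewrite fx.
Qed.

Lemma integral_torus_ge f (c : R) : measurable_fun setT f ->
  (forall z, 0 <= f z) -> (0 <= c)%R ->
  (forall z : spacetime R d, (forall i, 0 <= z.1 ord0 i <= 1)%R -> (0 <= z.2 <= 1)%R ->
    c%:E <= f z) ->
  c%:E <= \int[lebesgue_torus d]_z f z.
Proof.
move=> mf f0 c0 fc; rewrite integral_torus//.
apply: integral_cube_ge => //.
- exact: (@measurable_fun_fubini_tonelli_F _ _ _ _ _ (lebesgue_unit R) f).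
- by move=> x; apply: integral_ge0.
- move=> x x01; apply: (integral_unit_ge (f := fun t => f (x, t))) => //.
    by apply: (measurableT_comp mf); exact: measurable_pair1.
  by move=> t t01; exact: fc.
Qed.

End torus_integral.

(** * The Euler-Lagrange equation *)

Section torus_functions.
Context (R : realType) (d : nat).
Implicit Types f g : spacetime R d -> R.

Definition torus_function f := continuous f /\ torus_periodic f.

Lemma torus_functionD f g : torus_function f -> torus_function g ->
  torus_function (fun z => f z + g z).
Proof.
move=> [cf [fx ft]] [cg [gx gt]]; split.
  by move=> z; apply: cvgD; [exact: cf|exact: cg].
by split=> [i|] z; rewrite ?fx ?gx ?ft ?gt.
Qed.

Lemma torus_functionM f g : torus_function f -> torus_function g ->
  torus_function (fun z => f z * g z).
Proof.
move=> [cf [fx ft]] [cg [gx gt]]; split.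
  by move=> z; apply: cvgM; [exact: cf|exact: cg].
by split=> [i|] z; rewrite ?fx ?gx ?ft ?gt.
Qed.

Lemma torus_function_cst (c : R) : torus_function (fun=> c).
Proof. by split=> // z; exact: cvg_cst. Qed.

Lemma torus_function_comp f (h : R -> R) : continuous h -> torus_function f ->
  torus_function (fun z => h (f z)).
Proof.
move=> ch [cf [fx ft]]; split.
  by move=> z; apply: continuous_comp; [exact: cf|exact: ch].
by split=> [i|] z; rewrite ?fx ?ft.
Qed.

Lemma torus_function_translate f (h : spacetime R d) :
  torus_function f -> torus_function (fun z => f (z + h)).
Proof.
move=> [cf pf]; split; last exact: torus_periodic_translate.
move=> z; apply: (@continuous_comp _ _ _ (fun z : spacetime R d => z + h) f);
  last exact: cf.
by apply: cvgD; [exact: cvg_id|exact: cvg_cst].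
Qed.

Lemma torus_function_dot (p q : spacetime R d -> 'rV[R]_d) :
  (forall i, torus_function (fun z => p z ord0 i)) ->
  (forall i, torus_function (fun z => q z ord0 i)) ->
  torus_function (fun z => dot (p z) (q z)).
Proof.
move=> hp hq; split.
  by apply: continuous_dot; apply: continuous_row => i; case: (hp i); case: (hq i).
split=> [j|] z; apply: eq_bigr => i _;
  have [_ [px pt]] := hp i; have [_ [qx qt]] := hq i.
  by rewrite px qx.
by rewrite pt qt.
Qed.

Lemma torus_functionP f : torus_function f ->
  exists2 M, 0 < M & forall z, `|f z| <= M.
Proof.
move=> [cf pf]; have [M HM] := bounded_periodic cf pf.
exists (M + 1) => [|z]; last by rewrite (le_trans (HM z))// lerDl.
by apply: ltr_pwDr => //; exact: le_trans (normr_ge0 _) (HM 0).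
Qed.

Lemma integrable_bounded (d0 : measure_display) (T : measurableType d0)
    (P : probability T R) (f : T -> R) (M : R) :
  measurable_fun setT f -> (forall x, `|f x| <= M) ->
  P.-integrable setT (EFin \o f).
Proof.
move=> mf fM; apply: measurable_bounded_integrable => //.
  exact: (le_lt_trans (probability_le1 P measurableT) (ltry 1)).
by exists M; split=> [|N MN x _]; [exact: num_real|exact: le_trans (fM x) (ltW MN)].
Qed.

Lemma torus_integrable (P : probability (spacetime R d) R) f :
  torus_function f -> P.-integrable setT (EFin \o f).
Proof.
move=> tf; have [M _ HM] := torus_functionP tf.
apply: integrable_bounded HM; apply: measurable_continuous_spacetime; exact: tf.1.
Qed.

Lemma torus_Rintegral (P : probability (spacetime R d) R) f :
  torus_function f -> (\int[P]_z (f z)%:E = (\int[P]_z f z)%:E)%E.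
Proof.
move=> tf; rewrite /Rintegral fineK//; apply: integrable_fin_num => //.
exact: torus_integrable.
Qed.

Lemma Rintegral_prob_cst (d0 : measure_display) (T : measurableType d0)
  (P : probability T R) (c : R) : \int[P]_x c = c.
Proof.
rewrite Rintegral_cst// -[RHS]mulr1; congr (_ * _).
by rewrite -[RHS]/(fine 1%:E); congr fine; exact: probability_setT.
Qed.

Lemma torus_function_grad u i : Ck 1 u -> torus_periodic u ->
  torus_function (fun z => grad u z ord0 i).
Proof.
move=> Cu pu; split; first by apply: continuous_entry; exact: Ck1_grad.
have [gx gt] := periodic_grad pu.
by split=> [j|] z; rewrite ?gx ?gt.
Qed.

Lemma torus_function_dt u : Ck 1 u -> torus_periodic u ->
  torus_function (dt u).
Proof. by move=> Cu pu; split; [exact: Ck1_dt|exact: torus_periodic_dt]. Qed.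

End torus_functions.

(** From [expR y <= (1 - y)^-1], which is [1 - y <= expR (- y)] inverted. *)
Lemma expR_le_quadratic (R : realType) (y : R) : `|y| <= 2^-1 ->
  expR y <= 1 + y + 2 * y ^+ 2.
Proof.
rewrite ler_norml => /andP[y1 y2].
have e0 : 1 - y <= expR (- y) by exact: expR_ge1Dx.
have p0 : 0 < 1 - y by lra.
have : expR y <= (1 - y)^-1.
  by rewrite -[leLHS]invrK -expRN lef_pV2// posrE expR_gt0.
move/le_trans; apply; rewrite -[leLHS]mul1r ler_pdivrMr//.
have : 0 <= y ^+ 2 * (1 - 2 * y) by apply: mulr_ge0; [exact: sqr_ge0|lra].
lra.
Qed.

Lemma linear_term_eq0 (R : realType) (s0 a c : R) : 0 < s0 ->
  (forall s, `|s| <= s0 -> 0 <= s * a + s ^+ 2 * c) -> a = 0.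
Proof.
move=> s0p h; apply/eqP; apply/negPn/negP => a0.
have c0 : 0 < `|c| + 1 by rewrite ltr_wpDl.
pose s := Num.min s0 (`|a| / (2 * (`|c| + 1))).
have sp : 0 < s by rewrite lt_min s0p divr_gt0 ?normr_gt0// mulr_gt0.
have ss : `|s| <= s0 by rewrite gtr0_norm// ge_min lexx.
have sa : s * (2 * (`|c| + 1)) <= `|a|.
  by rewrite -ler_pdivlMr ?mulr_gt0// ge_min lexx orbT.
have h1 := h s ss; have := h (- s); rewrite normrN => /(_ ss) h2.
have cc : c <= `|c| by exact: ler_norm.
have a1 : 0 < `|a| by rewrite normr_gt0.
have {h1} h1 : 0 <= a + s * c.
  by rewrite -(pmulr_rge0 _ sp) mulrDr mulrA -expr2.
have {h2} h2 : 0 <= - a + s * c.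
  by rewrite -(pmulr_rge0 _ sp) mulrDr mulrA -expr2 mulrN -mulNr -(sqrrN s).
have : `|a| <= s * c by rewrite ler_norml; apply/andP; split; lra.
have : s * c <= s * `|c| by rewrite ler_pM2l.
nra.
Qed.

Section variation.
Context (R : realType) (d : nat) (eta : R -> 'rV[R]_d) (V : spacetime R d -> R).
Context (eta_per : periodic eta 1) (eta_cont : continuous eta).
Context (V_fun : torus_function V).
Let H := mechanical_hamiltonian eta V.
Local Notation leb := (@lebesgue_torus R d).

Lemma torus_function_eta i : torus_function (fun z : spacetime R d => eta z.2 ord0 i).
Proof.
split; last by split=> [j|] z; rewrite /= ?addr0 ?eta_per.
apply: continuous_entry => z.
by apply: (@continuous_comp _ _ _ snd eta); [exact: cvg_snd|exact: eta_cont].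
Qed.

Context (u : spacetime R d -> R) (Cu : Ck 1 u) (pu : torus_periodic u).

(** [H_p] along the graph of the gradient of [u]. *)
Definition velocity z := grad u z + eta z.2.

(** The left-hand side of the Hamilton-Jacobi equation, whose exponential is the
    integrand of the functional. *)
Definition hj_residual z := dt u z + H z (grad u z).

Lemma torus_function_velocity i : torus_function (fun z => velocity z ord0 i).
Proof.
have -> : (fun z => velocity z ord0 i) =
    (fun z => grad u z ord0 i + eta z.2 ord0 i).
  by apply/funext => z; rewrite mxE.
apply: torus_functionD; first exact: torus_function_grad.
exact: torus_function_eta.
Qed.

Lemma torus_function_residual : torus_function hj_residual.
Proof.
have -> : hj_residual = (fun z =>
    dt u z + (2^-1 * dot (velocity z) (velocity z) + V z)).
  by apply/funext => z; rewrite /hj_residual /H hamiltonianE.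
apply: torus_functionD; first exact: torus_function_dt.
apply: torus_functionD => //; apply: torus_functionM.
  exact: torus_function_cst.
by apply: torus_function_dot; exact: torus_function_velocity.
Qed.

Lemma torus_function_weight k : torus_function (exp_weight H k u).
Proof.
apply: torus_function_comp; first exact: continuous_expR.
by apply: torus_functionM;
  [exact: torus_function_cst|exact: torus_function_residual].
Qed.

Lemma exp_action_gt0 k : 0 < exp_action H k u.
Proof.
have [M M0 HM] := torus_functionP torus_function_residual.
apply: (@lt_le_trans _ _ (\int[leb]_z expR (k%:R * - M))).
  by rewrite Rintegral_prob_cst expR_gt0.
apply: le_Rintegral => //.
- by apply: torus_integrable; exact: torus_function_cst.
- by apply: torus_integrable; exact: torus_function_weight.
- move=> z _; rewrite ler_expR ler_wpM2l//.
  by have := HM z; rewrite ler_norml => /andP[].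
Qed.

(** The derivative of [phi] along the space-time flow of the velocity field. *)
Definition transport (phi : spacetime R d -> R) z :=
  dt phi z + dot (grad phi z) (velocity z).

Lemma torus_function_transport (phi : spacetime R d -> R) :
  Ck 1 phi -> torus_periodic phi ->
  torus_function (transport phi).
Proof.
move=> Cp pp; apply: torus_functionD; first exact: torus_function_dt.
apply: torus_function_dot; last exact: torus_function_velocity.
by move=> i; exact: torus_function_grad.
Qed.

(** The Hamiltonian is quadratic in the momentum, so its second-order expansion
    along [u + s phi] is exact. *)
Lemma weight_perturb k (phi : spacetime R d -> R) (s : R) z : Ck 1 phi ->
  exp_weight H k (fun y => u y + s * phi y) z = exp_weight H k u z *
  expR (k%:R * (s * transport phi z +
                s ^+ 2 * (2^-1 * dot (grad phi z) (grad phi z)))).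
Proof.
move=> Cp; rewrite /exp_weight -expRD dt_perturb// grad_perturb//.
congr expR; rewrite /H !hamiltonianE /transport /velocity.
rewrite !dotDl !dotDr !(dotZl, dotZr) (dotC (grad phi z) (grad u z)).
rewrite (dotC (eta _) (grad u z)) (dotC (eta _) (grad phi z)).
by field.
Qed.

(** The exact expansion of the exponent together with [expR_le_quadratic] bounds
    the variation of the functional from above by [s a + s ^+ 2 c], [a] being the
    integral in question up to the factor [k].  Minimality makes this nonnegative
    for all small [s] of either sign, hence [a = 0]; the functional is never
    differentiated under the integral sign. *)
Lemma euler_lagrange k (phi : spacetime R d -> R) :
  (0 < k)%N -> smooth_minimizer H k u ->
  Ck 1 phi -> torus_periodic phi ->
  \int[leb]_z (exp_weight H k u z * transport phi z) = 0.
Proof.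
move=> k0 [_ _ _ umin] Cp pp.
have k0' : (0 : R) < k%:R by rewrite ltr0n.
pose B z := 2^-1 * dot (grad phi z) (grad phi z).
have tB : torus_function B.
  apply: torus_functionM; first exact: torus_function_cst.
  by apply: torus_function_dot => i; exact: torus_function_grad.
have tA := torus_function_transport Cp pp.
have [MA MA0 HA] := torus_functionP tA; have [MB MB0 HB] := torus_functionP tB.
have tW := torus_function_weight k.
pose M := MA + MB; have M0 : 0 < M by rewrite addr_gt0.
pose C := k%:R * M + 8 * k%:R ^+ 2 * M ^+ 2.
(* For |s| <= s0 the exponent y below satisfies |y| <= 1 / 2. *)
pose s0 : R := Num.min 1 (4 * k%:R * M)^-1.
have s0p : 0 < s0 by rewrite lt_min ltr01 invr_gt0 !mulr_gt0.
have a0 : k%:R * \int[leb]_z (exp_weight H k u z * transport phi z) = 0.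
  apply: (@linear_term_eq0 _ s0 _ (C * exp_action H k u)) => // s ss.
  have s1 : `|s| <= 1 by rewrite (le_trans ss)// ge_min lexx.
  have sM : `|s| * (4 * k%:R * M) <= 1.
    rewrite -ler_pdivlMr ?mulr_gt0// div1r (le_trans ss)//.
    by rewrite ge_min lexx orbT.
  have key z : exp_weight H k (fun y => u y + s * phi y) z <=
      exp_weight H k u z +
      s * k%:R * (exp_weight H k u z * transport phi z) +
      s ^+ 2 * C * exp_weight H k u z.
    rewrite weight_perturb// -/(B z).
    have W0 : 0 < exp_weight H k u z by exact: expR_gt0.
    set W := exp_weight H k u z in W0 *; set A := transport phi z.
    pose y := k%:R * (s * A + s ^+ 2 * B z).
    have hA : `|A| <= M by rewrite (le_trans (HA z))// lerDl ltW.
    have hB : `|B z| <= M by rewrite (le_trans (HB z))// lerDr ltW.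
    have ss2 : s ^+ 2 = `|s| * `|s| by rewrite -normrM -expr2 ger0_norm ?sqr_ge0.
    have hy : `|y| <= 2 * k%:R * M * `|s|.
      rewrite normrM (ger0_norm (ltW k0')).
      have -> : 2 * k%:R * M * `|s| = k%:R * (`|s| * M + `|s| * M) by ring.
      rewrite ler_pM2l// (le_trans (ler_normD _ _))// lerD// normrM.
        by rewrite ler_wpM2l.
      rewrite (ger0_norm (sqr_ge0 _)) ss2 -mulrA ler_wpM2l//.
      by rewrite (le_trans _ hB)// ler_piMl.
    have hy2 : `|y| <= 2^-1 by lra.
    have y2 : y ^+ 2 <= 4 * k%:R ^+ 2 * M ^+ 2 * s ^+ 2.
      rewrite -[y ^+ 2]ger0_norm ?sqr_ge0// normrX.
      have -> : 4 * k%:R ^+ 2 * M ^+ 2 * s ^+ 2 = (2 * k%:R * M * `|s|) ^+ 2.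
        by rewrite !exprMn ss2 -expr2; ring.
      by rewrite ler_pXn2r// ?nnegrE// !mulr_ge0// ltW.
    have yB : y <= s * k%:R * A + s ^+ 2 * (k%:R * M).
      rewrite /y.
      have : s ^+ 2 * B z <= s ^+ 2 * M.
        by rewrite ler_wpM2l ?sqr_ge0// (le_trans (ler_norm _)).
      have : k%:R * (s ^+ 2 * B z) <= k%:R * (s ^+ 2 * M) -> 
        k%:R * (s * A + s ^+ 2 * B z) <= s * k%:R * A + s ^+ 2 * (k%:R * M) by lra.
      by move=> h1 h2; apply: h1; rewrite ler_pM2l.
    have -> : W + s * k%:R * (W * A) + s ^+ 2 * C * W =
        W * (1 + s * k%:R * A + s ^+ 2 * C) by ring.
    rewrite ler_pM2l// (le_trans (expR_le_quadratic hy2))//.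
    by move: y y2 yB {hy hy2} => y y2 yB; rewrite /C; lra.
  have tps : torus_periodic (fun y => u y + s * phi y).
    exact: torus_periodic_perturb.
  have Cps : Ck 1 (fun y => u y + s * phi y) by exact: Ck1_perturb.
  have tWA : torus_function (fun z => exp_weight H k u z * transport phi z).
    exact: torus_functionM.
  have tc (c : R) f : torus_function f ->
      torus_function (fun z : spacetime R d => c * f z).
    by move=> tf; apply: torus_functionM => //; exact: torus_function_cst.
  have tWs : torus_function (exp_weight H k (fun y => u y + s * phi y)).
    have -> : exp_weight H k (fun y => u y + s * phi y) = (fun z =>
      exp_weight H k u z * expR (k%:R * (s * transport phi z + s ^+ 2 * B z))).
      by apply/funext => z; rewrite weight_perturb.
    apply: (torus_functionM tW).
    apply: (torus_function_comp (@continuous_expR R)).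
    by apply: (tc); apply: torus_functionD; [exact: (tc _ _ tA)|exact: (tc _ _ tB)].
  have := umin _ tps Cps.
  have : exp_action H k (fun y => u y + s * phi y) <=
      \int[leb]_z (exp_weight H k u z +
      s * k%:R * (exp_weight H k u z * transport phi z) +
      s ^+ 2 * C * exp_weight H k u z).
    apply: le_Rintegral => //; first exact: torus_integrable.
    by apply: torus_integrable; apply: torus_functionD; [apply: torus_functionD|];
      rewrite //; apply: tc.
  rewrite RintegralD//; last 2 first.
  - by apply: torus_integrable; apply: torus_functionD => //; exact: tc.
  - by apply: torus_integrable; exact: tc.
  rewrite RintegralD//; last 2 first.
  - exact: torus_integrable.
  - by apply: torus_integrable; exact: tc.
  rewrite !RintegralZl//; try exact: torus_integrable.
  rewrite -/(exp_action H k u) => h1 h2; move: {h1 h2} (le_trans h2 h1).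
  move: {key} (exp_action H k u) (\int[leb]_z _) (C) => I a c.
  by move=> ?; lra.
by apply/eqP; move/eqP: a0; rewrite mulf_eq0 gt_eqF.
Qed.

End variation.

(** * Graph measures and their energy balance *)

Section density.
Context (d0 : measure_display) (T : measurableType d0) (R : realType).
Context (P : probability T R) (f : T -> R).
Context (mf : measurable_fun setT f) (f0 : forall x, 0 <= f x).
Context (f1 : (\int[P]_x (f x)%:E = 1)%E).
Local Open Scope ereal_scope.

(** The three proofs are arguments so that the probability structure can be
    attached to the constant itself. *)
Definition density_measure of measurable_fun setT f & (forall x, 0 <= f x)%R
  & \int[P]_x (f x)%:E = 1 : set T -> \bar R :=
  fun A => \int[P]_(x in A) (f x)%:E.

Local Notation Q := (density_measure mf f0 f1).

Let Q0 : Q set0 = 0. Proof. by rewrite /density_measure integral_set0. Qed.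

Let Q_ge0 A : 0 <= Q A.
Proof. by apply: integral_ge0 => x _; rewrite lee_fin. Qed.

Let Q_sigma_additive : semi_sigma_additive Q.
Proof.
apply: semi_sigma_additive_nng_induced; first exact/measurable_EFinP.
by move=> x; rewrite lee_fin.
Qed.

HB.instance Definition _ := isMeasure.Build _ _ _ Q Q0 Q_ge0 Q_sigma_additive.
HB.instance Definition _ := Measure_isProbability.Build _ _ R Q f1.

Definition density_probability : probability T R := Q.

Lemma density_dominated : density_probability `<< P.
Proof.
apply/null_content_dominatesP => A mA PA0; apply: null_set_integral => //.
by apply/measurable_funTS/measurable_EFinP.
Qed.

(** The given density agrees almost everywhere with the Radon-Nikodym derivative,
    because both have the same integral over every measurable set. *)
Lemma integral_density_probability (g : T -> \bar R) :
  density_probability.-integrable setT g ->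
  \int[density_probability]_x g x = \int[P]_x (g x * (f x)%:E).
Proof.
move=> ig; rewrite -(Radon_Nikodym_change_of_variables density_dominated)//.
have mg := measurable_int _ ig.
apply: ae_eq_integral => //.
- apply: emeasurable_funM => //; apply: (measurable_int P).
  by apply: Radon_Nikodym_integrable; exact: density_dominated.
- by apply: emeasurable_funM => //; exact/measurable_EFinP.
- apply: ae_eqe_mul2l => /=.
  rewrite Radon_NikodymE//=; first exact: density_dominated.
  move=> QP; case: cid => /= h [h1 h2 h3].
  apply: integral_ae_eq => //=; first exact/measurable_EFinP.
  by move=> E _ mE; rewrite -h3.
Qed.

End density.

Section phase_functions.
Context (R : realType) (d : nat).
Implicit Type F : phase R d -> R.

Definition phase_function F :=
  continuous F /\ forall v, torus_periodic (fun z => F (z, v)).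

Lemma phase_function_section F (w : spacetime R d -> 'rV[R]_d) :
  phase_function F -> (forall i, torus_function (fun z => w z ord0 i)) ->
  torus_function (fun z => F (z, w z)).
Proof.
move=> [cF pF] tw; split.
  move=> z; apply: (@continuous_comp _ _ _ (fun z => (z, w z)) F); last exact: cF.
  apply: (@continuous_pair _ _ _ id w) => [?|]; first exact: cvg_id.
  by apply: continuous_row => i; exact: (tw i).1.
have wx j z : w (z + (delta_mx ord0 j, 0)) = w z.
  by apply/rowP => i; have [_ [px _]] := tw i; rewrite px.
have wt z : w (z + (0, 1)) = w z.
  by apply/rowP => i; have [_ [_ pt]] := tw i; rewrite pt.
split=> [j|] z; rewrite ?wx ?wt.
  by have [px _] := pF (w z); rewrite px.
by have [_ pt] := pF (w z); rewrite pt.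
Qed.

Lemma phase_function_comp (h : R -> R) F : continuous h -> phase_function F ->
  phase_function (fun w => h (F w)).
Proof.
move=> ch [cF pF]; split.
  by move=> z; apply: continuous_comp; [exact: cF|exact: ch].
by move=> v; have [px pt] := pF v; split=> [i|] z; rewrite /= ?px ?pt.
Qed.

Lemma phase_functionD F F' : phase_function F -> phase_function F' ->
  phase_function (fun w => F w + F' w).
Proof.
move=> [cF pF] [cF' pF']; split.
  by move=> z; apply: cvgD; [exact: cF|exact: cF'].
move=> v; have [px pt] := pF v; have [px' pt'] := pF' v.
by split=> [i|] z; rewrite ?px ?pt ?px' ?pt'.
Qed.

Lemma phase_functionM F F' : phase_function F -> phase_function F' ->
  phase_function (fun w => F w * F' w).
Proof.
move=> [cF pF] [cF' pF']; split.
  by move=> z; apply: cvgM; [exact: cF|exact: cF'].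
move=> v; have [px pt] := pF v; have [px' pt'] := pF' v.
by split=> [i|] z; rewrite ?px ?pt ?px' ?pt'.
Qed.

Lemma phase_function_cst (c : R) : phase_function (fun=> c).
Proof. by split=> // z; exact: cvg_cst. Qed.

Lemma phase_function_base (f : spacetime R d -> R) : torus_function f ->
  phase_function (fun w => f w.1).
Proof.
move=> [cf pf]; split=> // w.
by apply: (@continuous_comp _ _ _ fst f); [exact: cvg_fst|exact: cf].
Qed.

Lemma phase_function_dot_base (p : spacetime R d -> 'rV[R]_d) :
  (forall i, torus_function (fun z => p z ord0 i)) ->
  phase_function (fun w => dot (p w.1) w.2).
Proof.
move=> tp; split.
  apply: continuous_dot; last by move=> w; exact: cvg_snd.
  apply: continuous_row => i w.
  by apply: (@continuous_comp _ _ _ fst (fun z => p z ord0 i));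
    [exact: cvg_fst|exact: (tp i).1].
move=> v; split=> [j|] z; apply: eq_bigr => i _ /=;
  have [_ [px pt]] := tp i; by rewrite ?px ?pt.
Qed.

Lemma phase_function_dot : phase_function (fun w => dot w.2 w.2).
Proof.
split; first by apply: continuous_dot => w; exact: cvg_snd.
by move=> v.
Qed.

Lemma phase_function_enorm : phase_function (fun w => enorm w.2).
Proof.
apply: (phase_function_comp (h := @Num.sqrt R) (F := fun w => dot w.2 w.2)).
  exact: sqrt_continuous.
exact: phase_function_dot.
Qed.

Lemma measurable_phase_function F : phase_function F -> measurable_fun setT F.
Proof. by move=> [cF _]; exact: measurable_continuous_phase. Qed.

End phase_functions.

Section graph_measures.
Context (R : realType) (d : nat) (eta : R -> 'rV[R]_d) (V : spacetime R d -> R).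
Context (eta_per : periodic eta 1) (eta_cont : continuous eta).
Context (V_fun : torus_function V).
Let H := mechanical_hamiltonian eta V.
Local Notation leb := (@lebesgue_torus R d).
Context (k : nat) (k0 : (0 < k)%N) (u : spacetime R d -> R).
Context (umin : smooth_minimizer H k u).
Let m := min_density H k u.
Let vel := velocity eta u.
Let I := exp_action H k u.

Let Cu : Ck 1 u. Proof. by have [_ su _ _] := umin; exact: su. Qed.
Let pu : torus_periodic u. Proof. by have [] := umin. Qed.
Let I0 : 0 < I. Proof. exact: exp_action_gt0. Qed.

Lemma torus_function_min_density : torus_function m.
Proof.
apply: torus_functionM; first exact: torus_function_weight.
exact: torus_function_cst.
Qed.

Lemma min_density_gt0 z : 0 < m z.
Proof. by rewrite divr_gt0// expR_gt0. Qed.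

Lemma min_density_int1 : \int[leb]_z m z = 1.
Proof.
rewrite /m /min_density RintegralZr//; first by rewrite divff// gt_eqF.
by apply: torus_integrable; exact: torus_function_weight.
Qed.

(** The logarithm of the density is affine in the Hamilton-Jacobi residual: this
    links the entropy of the minimizer to its energy. *)
Lemma ln_min_density z : ln (m z) = k%:R * hj_residual eta V u z - ln I.
Proof. by rewrite ln_div ?posrE ?expR_gt0// expRK. Qed.

Lemma torus_function_ln_min_density : torus_function (fun z => ln (m z)).
Proof.
have -> : (fun z => ln (m z)) =
    (fun z => k%:R * hj_residual eta V u z + - ln I).
  by apply/funext => z; rewrite ln_min_density.
apply: torus_functionD; last exact: torus_function_cst.
apply: torus_functionM; first exact: torus_function_cst.
exact: torus_function_residual.
Qed.

Definition min_entropy : R := \int[leb]_z (m z * ln (m z)).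

Lemma torus_function_min_entropy : torus_function (fun z => m z * ln (m z)).
Proof.
exact: (torus_functionM torus_function_min_density torus_function_ln_min_density).
Qed.

(** The Euler-Lagrange equation, normalized by the value of the functional. *)
Lemma transport_balance phi : Ck 1 phi -> torus_periodic phi ->
  \int[leb]_z (transport eta u phi z * m z) = 0.
Proof.
move=> Cp pp.
have -> : (fun z => transport eta u phi z * m z) =
    (fun z => I^-1 * (exp_weight H k u z * transport eta u phi z)).
  by apply/funext => z; rewrite /m /min_density; ring.
rewrite RintegralZl//; last first.
  apply: torus_integrable; apply: torus_functionM.
    exact: torus_function_weight.
  exact: torus_function_transport.
by rewrite euler_lagrange// mulr0.
Qed.

Context (mu : probability (phase R d) R) (mu_graph : is_graph_measure H k u mu).

Lemma graph_integral F : phase_function F ->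
  (\int[mu]_w (F w)%:E = (\int[leb]_z (F (z, vel z) * m z))%:E)%E.
Proof.
move=> pF; have [_ /(_ F pF.1 pF.2) ->] := mu_graph.
rewrite -torus_Rintegral; last first.
  apply: torus_functionM; last exact: torus_function_min_density.
  by apply: phase_function_section => // i; exact: torus_function_velocity.
by apply: eq_integral => z _; rewrite grad_p_mechanical.
Qed.

Lemma graph_integrable F : phase_function F -> mu.-integrable setT (EFin \o F).
Proof.
move=> pF; apply/integrableP; split.
  by apply/measurable_EFinP; exact: measurable_phase_function.
rewrite (_ : (fun x => _) = (fun w => (`|F w|)%:E)); last by apply/funext.
rewrite graph_integral ?ltry//.
by apply: phase_function_comp => //; exact: norm_continuous.
Qed.

Lemma graph_admissible : admissible mu.
Proof.
split; first by case: mu_graph.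
  by rewrite graph_integral ?ltry//; exact: phase_function_enorm.
move=> phi pp Cp.
have pF : phase_function (fun w => dt phi w.1 + dot (grad phi w.1) w.2).
  apply: phase_functionD.
    by apply: phase_function_base; exact: torus_function_dt.
  by apply: phase_function_dot_base => i; exact: torus_function_grad.
by rewrite graph_integral//= transport_balance.
Qed.

Lemma phase_function_lagrangian :
  phase_function (fun w => lagrangian eta V w.1 w.2).
Proof.
have -> : (fun w : phase R d => lagrangian eta V w.1 w.2) =
    (fun w => 2^-1 * dot w.2 w.2 +
      ((-1) * dot (eta w.1.2) w.2 + (-1) * V w.1)).
  by apply/funext => w; rewrite /lagrangian; ring.
apply: phase_functionD.
  apply: phase_functionM; first exact: phase_function_cst.
  exact: phase_function_dot.
apply: phase_functionD; apply: phase_functionM;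
  try exact: phase_function_cst.
  apply: (@phase_function_dot_base _ _ (fun z => eta z.2)) => i.
  exact: torus_function_eta.
exact: phase_function_base.
Qed.

(** On the graph, equality in Fenchel-Young gives [L = u_t + v . grad u - G], where
    [G] is the Hamilton-Jacobi residual; the first two terms integrate to zero by
    the Euler-Lagrange equation tested with [u], and [G = (ln m + ln I) / k]. *)
Lemma graph_energy :
  (\int[mu]_w (lagrangian eta V w.1 w.2)%:E =
   (- (ln I / k%:R) - min_entropy / k%:R)%:E)%E.
Proof.
rewrite graph_integral; last exact: phase_function_lagrangian.
congr EFin => /=; have k1 : k%:R != 0 :> R by rewrite pnatr_eq0 -lt0n.
have -> : (fun z => lagrangian eta V z (vel z) * m z) =
    (fun z => transport eta u u z * m z +
      (- k%:R^-1 * (m z * ln (m z)) + - (ln I / k%:R) * m z)).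
  apply/funext => z; rewrite ln_min_density.
  have := fenchel_young_eq eta V z (grad u z).
  rewrite /transport /hj_residual -/(velocity eta u z) -/vel -/H => e.
  have -> : lagrangian eta V z (vel z) = dot (grad u z) (vel z) - H z (grad u z).
    by rewrite e addrAC subrr add0r.
  by field.
have tm := torus_function_min_density.
have te := torus_function_min_entropy.
have tt : torus_function (fun z => transport eta u u z * m z).
  by apply: torus_functionM tm; exact: torus_function_transport.
have tc (c : R) f : torus_function f ->
    torus_function (fun z : spacetime R d => c * f z).
  by move=> tf; apply: torus_functionM => //; exact: torus_function_cst.
rewrite RintegralD//; last 2 first.
- exact: torus_integrable.
- by apply: torus_integrable; apply: torus_functionD; exact: tc.
rewrite transport_balance// add0r RintegralD//; last 2 first.
- by apply: torus_integrable; exact: tc.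
- by apply: torus_integrable; exact: tc.
rewrite !RintegralZl//; try exact: torus_integrable.
by rewrite min_density_int1 -/min_entropy; field.
Qed.

End graph_measures.

(** * Entropy *)

Section entropy_bounds.
Context (R : realType).
Local Open Scope ereal_scope.

(** The integral of [g] may be infinite here; comparing positive and negative parts
    separately covers that case. *)
Lemma le_integral_integrable_minorant (d0 : measure_display)
    (T : measurableType d0) (mu : {measure set T -> \bar R})
    (h g : T -> \bar R) :
  mu.-integrable setT h -> measurable_fun setT g -> (forall x, h x <= g x) ->
  \int[mu]_x h x <= \int[mu]_x g x.
Proof.
move=> ih mg hg; rewrite integralE [leRHS]integralE.
have mh := measurable_int _ ih.
apply: leeB; apply: ge0_le_integral => //.
- exact: measurable_funepos.
- exact: measurable_funepos.
- by move=> x _; apply: (@funepos_le _ _ setT) => [y _|]; rewrite ?inE.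
- exact: measurable_funeneg.
- exact: measurable_funeneg.
- by move=> x _; apply: (@funeneg_le _ _ setT) => [y _|]; rewrite ?inE.
Qed.

Lemma xlnx_ge (x : R) : (0 <= x -> x - 1 <= x * ln x)%R.
Proof.
rewrite le_eqVlt => /predU1P[<-|x0].
  by rewrite mul0r sub0r lerN10.
have h : (- ln x <= x^-1 - 1)%R.
  rewrite -lnV ?posrE//.
  have := @le_ln1Dx R (x^-1 - 1); rewrite addrCA subrr addr0; apply.
  by rewrite ltrBrDl subrr invr_gt0.
have := ler_wpM2l (ltW x0) h.
rewrite mulrBr mulfV ?gt_eqF// mulr1 mulrN; lra.
Qed.

(** Integrate [xlnx_ge]: the torus has volume one and [f] has mass one. *)
Lemma entropy_density_ge0 d (m : probability (spacetime R d) R)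
    (f : spacetime R d -> R) : has_density m f -> 0 <= entropy_density f.
Proof.
move=> [mf f0 mE].
have f1 : \int[lebesgue_torus d]_z (f z)%:E = 1.
  by rewrite -mE// probability_setT.
have fint : (lebesgue_torus d).-integrable setT (EFin \o f).
  apply/integrableP; split; first exact/measurable_EFinP.
  under eq_integral do rewrite /= ger0_norm//.
  by rewrite f1 ltry.
have cint : (lebesgue_torus d).-integrable setT (EFin \o (fun=> 1%R : R)).
  by apply: torus_integrable; exact: torus_function_cst.
apply: (@le_trans _ _ (\int[lebesgue_torus d]_z ((f z)%:E - 1%:E))).
  rewrite integralB//.
  rewrite f1 integral_cst//= mul1e.
  by rewrite [X in 1 - X](_ : _ = 1) ?subee//; exact: probability_setT.
apply: le_integral_integrable_minorant.
- exact: (integrableB _ fint cint).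
- apply/measurable_EFinP; apply: measurable_funM => //.
  by apply: measurableT_comp mf; exact: measurable_ln.
- by move=> z; rewrite lee_fin xlnx_ge.
Qed.

Lemma limn_einf_ge (v : (\bar R)^nat) (c : \bar R) :
  (forall n, c <= v n) -> c <= limn_einf v.
Proof.
move=> cv; rewrite limn_einf_lim; apply: lime_ge; first exact: is_cvg_einfs.
apply: nearW => n; apply: le_ereal_inf_tmp => _ [k _ <-]; exact: cv.
Qed.

Lemma limn_einf_cst (c : \bar R) : limn_einf (fun=> c) = c.
Proof.
apply/eqP; rewrite eq_le limn_einf_ge// andbT.
rewrite limn_einf_lim; apply: lime_le; first exact: is_cvg_einfs.
by apply: nearW => n; apply: ereal_inf_lbound; exists n => /=.
Qed.

Lemma entropy_ge0 d (mu : set (phase R d) -> \bar R) : 0 <= entropy mu.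
Proof.
apply: le_ereal_inf_tmp => _ [mn [f [hd _ ->]]].
by apply: limn_einf_ge => n; exact: entropy_density_ge0 (hd n).
Qed.

End entropy_bounds.

Section graph_entropy.
Context (R : realType) (d : nat) (eta : R -> 'rV[R]_d) (V : spacetime R d -> R).
Context (eta_per : periodic eta 1) (eta_cont : continuous eta).
Context (V_fun : torus_function V).
Let H := mechanical_hamiltonian eta V.
Local Notation leb := (@lebesgue_torus R d).
Context (k : nat) (k0 : (0 < k)%N) (u : spacetime R d -> R).
Context (umin : smooth_minimizer H k u).
Context (mu : probability (phase R d) R) (mu_graph : is_graph_measure H k u mu).
Let m := min_density H k u.

(** The constant sequence equal to the measure with density [m] is a competitor in
    the infimum that defines the relaxed entropy.  Its weak limit is the projection
    of [mu], because both integrate periodic functions of the base point alike. *)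
Lemma graph_entropy_le :
  (entropy mu <= (min_entropy eta V k u)%:E)%E.
Proof.
have tm : torus_function m by exact: torus_function_min_density.
have mm : measurable_fun setT m by exact: measurable_continuous_spacetime tm.1.
have m0 z : 0 <= m z by apply: ltW; exact: min_density_gt0.
have m1 : (\int[leb]_z (m z)%:E = 1)%E.
  rewrite torus_Rintegral//; congr EFin; exact: min_density_int1.
apply: ereal_inf_lbound.
exists (fun=> density_probability mm m0 m1), (fun=> m); split.
- by move=> _; split.
- move=> phi cphi pphi.
  have tphi : torus_function phi by split.
  have pF := phase_function_base tphi.
  rewrite [X in _ --> X](_ : _ =
      \int[density_probability mm m0 m1]_z (phi z)%:E)%E; first exact: cvg_cst.
  rewrite integral_density_probability; last exact: torus_integrable.
  rewrite integral_pushforward//; last first.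
  - exact: (graph_integrable eta_per eta_cont V_fun umin mu_graph pF).
  - by apply/measurable_EFinP; exact: measurable_continuous_spacetime.
  rewrite preimage_setT.
  rewrite [LHS](graph_integral eta_per eta_cont V_fun umin mu_graph pF)//=.
  rewrite -torus_Rintegral//; last exact: torus_functionM.
- rewrite limn_einf_cst /entropy_density -torus_Rintegral//.
  exact: torus_function_min_entropy.
Qed.

Lemma min_entropy_ge0 : 0 <= min_entropy eta V k u.
Proof.
rewrite -lee_fin; apply: le_trans graph_entropy_le; exact: entropy_ge0.
Qed.

End graph_entropy.

(** * The action of admissible measures *)

Section quadratic_growth.
Context (R : realType) (d : nat).

Definition second_moment (nu : probability (phase R d) R) :=
  nu.-integrable setT (fun w => (dot w.2 w.2)%:E).

Lemma quadratic_growth_integrable (nu : probability (phase R d) R)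
    (F : phase R d -> R) (C D : R) :
  second_moment nu -> measurable_fun setT F ->
  (forall w, `|F w| <= C + D * dot w.2 w.2) ->
  nu.-integrable setT (EFin \o F).
Proof.
move=> i2 mF FC.
have ib : nu.-integrable setT (EFin \o (fun w => C + D * dot w.2 w.2)).
  rewrite (_ : _ \o _ = (cst C%:E \+ (fun w => D%:E * (dot w.2 w.2)%:E))%E); last first.
    by apply/funext => w /=; rewrite EFinD EFinM.
  apply: integrableD => //; last exact: integrableZl.
  by apply: (@integrable_bounded _ _ _ nu (fun=> C) `|C|).
apply: le_integrable ib => //; first exact/measurable_EFinP.
move=> w _; rewrite lee_fin /=; apply: le_trans (FC w) _; exact: ler_norm.
Qed.

Lemma dot_le (p v : 'rV[R]_d) : `|dot p v| <= dot v v + dot p p.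
Proof.
have := norm_dot_le p v (@ltr01 R); rewrite mulr1 mul1r => /le_trans; apply.
have := dot_ge0 p; lra.
Qed.

End quadratic_growth.

Section lower_bound.
Context (R : realType) (d : nat) (eta : R -> 'rV[R]_d) (V : spacetime R d -> R).
Context (eta_per : periodic eta 1) (eta_cont : continuous eta).
Context (V_fun : torus_function V).
Let H := mechanical_hamiltonian eta V.
Local Notation leb := (@lebesgue_torus R d).
Local Notation L := (lagrangian eta V).

Lemma lagrangian_growth : exists2 C, 0 <= C & forall z v,
  `|L z v| <= C + 2 * dot v v /\ 4^-1 * dot v v - C <= L z v.
Proof.
have te : torus_function (fun z : spacetime R d => dot (eta z.2) (eta z.2)).
  by apply: torus_function_dot => i; exact: torus_function_eta.
have [M M0 HM] := torus_functionP te; have [K K0 HK] := torus_functionP V_fun.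
exists (M + K) => [|z v]; first by rewrite addr_ge0// ltW.
have := HK z; rewrite ler_norml => /andP[k1 k2].
have := HM z; rewrite ler_norml => /andP[_ m2].
have q4 : 0 < (4^-1 : R) by rewrite invr_gt0.
have := norm_dot_le (eta z.2) v q4.
have -> : (4 * 4^-1)^-1 = 1 :> R by rewrite mulfV ?invr1// pnatr_eq0.
have := dot_ge0 v; have := dot_ge0 (eta z.2).
rewrite !ler_norml mul1r => h1 h2 /andP[h3 h4]; rewrite /lagrangian.
by split; [apply/andP; split; lra|lra].
Qed.

Lemma lagrangian_translate_continuous (h : spacetime R d) :
  continuous (fun w : phase R d => L (w.1 + h) w.2).
Proof.
have [cL _] := phase_function_lagrangian eta_per eta_cont V_fun.
move=> w; apply: (@continuous_comp _ _ _ (fun w : phase R d => (w.1 + h, w.2))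
  (fun w => L w.1 w.2)); last exact: cL.
apply: (@continuous_pair _ _ _ (fun w : phase R d => w.1 + h) snd) => w'.
  by apply: cvgD; [exact: cvg_fst|exact: cvg_cst].
exact: cvg_snd.
Qed.

Lemma lagrangian_translate_integrable (nu : probability (phase R d) R) h :
  second_moment nu -> nu.-integrable setT (fun w => (L (w.1 + h) w.2)%:E).
Proof.
move=> i2; have [C _ HC] := lagrangian_growth.
apply: (quadratic_growth_integrable (F := fun w => L (w.1 + h) w.2)
  (C := C) (D := 2)) => //.
  by apply: measurable_continuous_phase; exact: lagrangian_translate_continuous.
by move=> w; exact: (HC _ _).1.
Qed.

(** Dominated convergence, the dominating function having quadratic growth. *)
Lemma cvg_lagrangian_translate (nu : probability (phase R d) R)
    (h : nat -> spacetime R d) :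
  second_moment nu -> h n @[n --> \oo] --> (0 : spacetime R d) ->
  \int[nu]_w (L (w.1 + h n) w.2) @[n --> \oo] --> \int[nu]_w L w.1 w.2.
Proof.
move=> i2 h0; have [C C0 HC] := lagrangian_growth.
have i0 : nu.-integrable setT (fun w => (L w.1 w.2)%:E).
  have := lagrangian_translate_integrable 0 i2.
  by under eq_fun do rewrite addr0.
have [] := @dominated_convergence _ _ _ nu setT measurableT
  (fun n w => (L (w.1 + h n) w.2)%:E) (fun w => (L w.1 w.2)%:E)
  (fun w => (C + 2 * dot w.2 w.2)%:E); last 1 first.
  move=> _ _ cv; apply: fine_cvg; rewrite fineK//.
  exact: integrable_fin_num i0.
- by move=> n; exact: measurable_int (lagrangian_translate_integrable (h n) i2).
- exact: measurable_int i0.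
- apply: aeW => w _; apply: cvg_EFin; first exact: nearW.
  have [cL _] := phase_function_lagrangian eta_per eta_cont V_fun.
  have cz : w.1 + h n @[n --> \oo] --> w.1.
    by rewrite -[X in _ --> X]addr0; apply: cvgD; [exact: cvg_cst|exact: h0].
  have cw : (fun n => (w.1 + h n, w.2)) @ \oo --> (w.1, w.2).
    by apply: cvgn_pair cz _; exact: cvg_cst.
  exact: (cvg_comp _ (fun w => L w.1 w.2) cw (cL (w.1, w.2))).
- apply: (quadratic_growth_integrable (F := fun w => C + 2 * dot w.2 w.2)
    (C := C) (D := 2)) => //.
    apply: measurable_phase_function; apply: phase_functionD.
      exact: phase_function_cst.
    apply: phase_functionM; first exact: phase_function_cst.
    exact: phase_function_dot.
  by move=> w; rewrite ger0_norm// addr_ge0// mulr_ge0// dot_ge0.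
- by apply: aeW => w n _; rewrite lee_fin; exact: (HC _ _).1.
Qed.

(** An admissible measure may be singular, whereas only the Lebesgue integral of [g]
    is under control.  Averaging over translations in a cube of side [e] turns one
    into the other: by Tonelli and [integral_torus_rescale_le] the average over [y]
    of the integral of [g (z + e y)] against [nu] is at most [J], so some translate
    does not exceed [2 * J]. *)
Lemma averaged_translate (nu : probability (phase R d) R)
    (g : spacetime R d -> R) (e J : R) :
  0 < e <= 1 -> torus_function g -> (forall z, 0 <= g z) ->
  0 < J -> e ^- d.+1 * \int[leb]_z g z <= J ->
  exists h : spacetime R d, [/\ forall i, 0 <= h.1 ord0 i <= e, 0 <= h.2 <= e &
    \int[nu]_w g (w.1 + h) <= 2 * J].
Proof.
move=> e01 tg g0 J0 IJ; have e0 : 0 < e by case/andP: e01.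
apply: contrapT => nh.
pose F (p : phase R d * spacetime R d) := (g (p.1.1 + e *: p.2))%:E.
have cF : continuous (fun p : phase R d * spacetime R d => g (p.1.1 + e *: p.2)).
  move=> p; apply: (@continuous_comp _ _ _
    (fun p : phase R d * spacetime R d => p.1.1 + e *: p.2) g); last exact: tg.1.
  apply: cvgD.
    by apply: (@continuous_comp _ _ _ fst fst); exact: cvg_fst.
  by apply: cvgZ; [exact: cvg_cst|exact: cvg_snd].
have mF : measurable_fun setT F.
  by apply/measurable_EFinP; exact: measurable_continuous_phase_spacetime.
have F0 p : (0 <= F p)%E by rewrite lee_fin.
have gi h : nu.-integrable setT (fun w => (g (w.1 + h))%:E).
  have [M _ HM] := torus_functionP tg.
  apply: (@integrable_bounded _ _ _ nu (fun w => g (w.1 + h)) M) => //.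
  apply: measurable_continuous_phase => w.
  apply: (@continuous_comp _ _ _ (fun w : phase R d => w.1 + h) g); last exact: tg.1.
  by apply: cvgD; [exact: cvg_fst|exact: cvg_cst].
have le1 : (\int[nu]_w \int[leb]_y F (w, y) <= J%:E)%E.
  apply: (@le_trans _ _ (\int[nu]_w J%:E)%E); last first.
    rewrite integral_cst// [X in (_ * X)%E](_ : _ = 1%E) ?mule1//.
    exact: probability_setT.
  apply: ge0_le_integral => //.
  - by move=> w _; apply: integral_ge0.
  - exact: (@measurable_fun_fubini_tonelli_F _ _ _ _ _ leb F).
  - move=> w _.
    apply: (le_trans (integral_torus_rescale_le (f := fun z => (g z)%:E)
      w.1 e01 _ _ _ _)) => //.
    + by apply/measurable_EFinP; exact: measurable_continuous_spacetime tg.1.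
    + move=> i x t; have [_ [gx _]] := tg; congr EFin; rewrite -(gx i (x, t)).
      by congr g; apply/pair_eqP; rewrite /= addr0 !eqxx.
    + move=> x t; have [_ [_ gt]] := tg; congr EFin; rewrite -(gt (x, t)).
      by congr g; apply/pair_eqP; rewrite /= addr0 !eqxx.
    + by rewrite torus_Rintegral// -EFinM lee_fin.
have le2 : ((2 * J)%:E <= \int[leb]_y \int[nu]_w F (w, y))%E.
  apply: integral_torus_ge.
  - exact: (@measurable_fun_fubini_tonelli_G _ _ _ _ _ nu F).
  - by move=> y; apply: integral_ge0.
  - by rewrite mulr_ge0// ltW.
  move=> y yx yt; rewrite leNgt; apply/negP => lt2; apply: nh.
  exists (e *: y); split.
  - move=> i; have /andP[y0 y1] := yx i.
    rewrite /= mxE; apply/andP; split; first exact: mulr_ge0 (ltW e0) y0.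
    by rewrite ler_piMr// ltW.
  - have /andP[y0 y1] := yt; apply/andP; split.
      exact: (mulr_ge0 (ltW e0) y0).
    by rewrite [leLHS](_ : _ = e * y.2)// ler_piMr// ltW.
  - by rewrite -lee_fin [leLHS]fineK ?ltW//; exact: integrable_fin_num (gi _).
have ft : (\int[leb]_y \int[nu]_w F (w, y) = \int[nu]_w \int[leb]_y F (w, y))%E.
  exact: (esym (@fubini_tonelli _ _ _ _ _ nu leb F mF F0)).
by move: le2; rewrite ft => /le_trans/(_ le1); rewrite lee_fin; lra.
Qed.

(** Test the constraint with the translate of [u] by [h], where [h] comes from
    [averaged_translate] with [e = 1 / k].  With [G] the Hamilton-Jacobi residual,
    Fenchel-Young bounds [u_t + v . grad u] by [G + L], and the tangent line of the
    logarithm at [2 J] bounds [k G] by [ln (2 J) + exp (k G) / (2 J) - 1], whose last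
    two terms have nonpositive integral by the choice of [h].  The concentration
    scale [1 / k] costs only [(d + 1) ln k / k], since
    [J = k ^ (d + 1) I]. *)
Lemma minimizer_lower_bound (nu : probability (phase R d) R) k u :
  (0 < k)%N -> Ck 1 u -> torus_periodic u -> admissible nu ->
  second_moment nu ->
  exists h : spacetime R d,
    [/\ forall i, 0 <= h.1 ord0 i <= k%:R^-1, 0 <= h.2 <= k%:R^-1 &
    - (ln (exp_action H k u) / k%:R) <=
      (ln 2 + d.+1%:R * ln k%:R) / k%:R + \int[nu]_w L (w.1 + h) w.2].
Proof.
move=> k0 Cu pu [_ _ adm] i2.
have kp : (0 : R) < k%:R by rewrite ltr0n.
pose I := exp_action H k u.
have I0 : 0 < I by exact: exp_action_gt0.
have tW : torus_function (exp_weight H k u) by exact: torus_function_weight.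
pose J := k%:R ^+ d.+1 * I.
have J0 : 0 < J by rewrite mulr_gt0// exprn_gt0.
have [] := @averaged_translate nu (exp_weight H k u) k%:R^-1 J _ tW _ J0.
- by rewrite invr_gt0 kp invf_le1// ler1n.
- by move=> z; apply: ltW; exact: expR_gt0.
- by rewrite exprVn invrK.
move=> h [hx ht hJ]; exists h; split=> //.
have tu := torus_periodic_translate h pu; have Ct := Ck1_translate h Cu.
pose F w := dt u (w.1 + h) + dot (grad u (w.1 + h)) w.2.
have F0 : (\int[nu]_w (F w)%:E = 0)%E.
  rewrite -[RHS](adm _ tu Ct); apply: eq_integral => w _.
  by rewrite /F dt_translate grad_translate.
have tdt : torus_function (fun z => dt u (z + h)).
  rewrite (_ : (fun z => _) = dt (fun y => u (y + h))).
    exact: torus_function_dt.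
  by apply/funext => z; rewrite dt_translate.
have tgr i : torus_function (fun z => grad u (z + h) ord0 i).
  rewrite (_ : (fun z => _) = (fun z => grad (fun y => u (y + h)) z ord0 i)).
    exact: torus_function_grad.
  by apply/funext => z; rewrite grad_translate.
have tWh : torus_function (fun z => exp_weight H k u (z + h)).
  exact: torus_function_translate.
have iF : nu.-integrable setT (EFin \o F).
  have [M _ HM] := torus_functionP tdt.
  have [K _ HK] := torus_functionP (torus_function_dot tgr tgr).
  apply: (quadratic_growth_integrable (C := M + K) (D := 1)) => //.
    apply: measurable_phase_function; apply: phase_functionD.
      exact: (phase_function_base tdt).
    exact: (phase_function_dot_base tgr).
  move=> w; apply: le_trans (ler_normD _ _) _.
  have := HM w.1; have := HK w.1; rewrite ger0_norm ?dot_ge0//.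
  by have := dot_le (grad u (w.1 + h)) w.2; lra.
have iW : nu.-integrable setT (fun w => (exp_weight H k u (w.1 + h))%:E).
  have [M _ HM] := torus_functionP tWh.
  apply: (@integrable_bounded _ _ _ nu (fun w => exp_weight H k u (w.1 + h)) M) => //.
  exact: measurable_phase_function (phase_function_base tWh).
have iL := lagrangian_translate_integrable h i2.
have J2 : 0 < 2 * J by rewrite mulr_gt0.
have lnJ : ln (2 * J) = ln 2 + d.+1%:R * ln k%:R + ln I.
  rewrite lnM ?posrE// lnM ?posrE ?exprn_gt0// lnXn// addrA.
  by rewrite [in RHS]mulr_natl.
pose c := (ln (2 * J) - 1) / k%:R.
have ptw w : F w <=
    c + (k%:R * (2 * J))^-1 * exp_weight H k u (w.1 + h) + L (w.1 + h) w.2.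
  have := fenchel_young eta V (w.1 + h) (grad u (w.1 + h)) w.2; rewrite -/H => fy.
  have lnW : ln (exp_weight H k u (w.1 + h) / (2 * J)) =
      k%:R * (dt u (w.1 + h) + H (w.1 + h) (grad u (w.1 + h))) - ln (2 * J).
    by rewrite ln_div ?posrE ?expR_gt0// expRK.
  have W0 : 0 < exp_weight H k u (w.1 + h) by exact: expR_gt0.
  move: lnW W0; set W := exp_weight _ _ _ _; set S := dt _ _ + H _ _ => lnW W0.
  have := @le_ln1Dx R (W / (2 * J) - 1); rewrite addrCA subrr addr0 lnW.
  rewrite ltrBrDl subrr divr_gt0// => /(_ isT) hln.
  have : S <= c + (k%:R * (2 * J))^-1 * W.
    rewrite /c -(ler_pM2l kp).
    have -> : k%:R * ((ln (2 * J) - 1) / k%:R + (k%:R * (2 * J))^-1 * W) =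
      ln (2 * J) - 1 + W / (2 * J) by field; rewrite !gt_eqF.
    lra.
  by rewrite /F /S; lra.
have ic : nu.-integrable setT (EFin \o (fun=> c : R)).
  by apply: (@integrable_bounded _ _ _ nu (fun=> c) `|c|).
have iW' : nu.-integrable setT
    (EFin \o (fun w => (k%:R * (2 * J))^-1 * exp_weight H k u (w.1 + h))).
  by have := integrableZl measurableT (k%:R * (2 * J))^-1 iW.
have icW : nu.-integrable setT
    (EFin \o (fun w =>
      c + (k%:R * (2 * J))^-1 * exp_weight H k u (w.1 + h))).
  by have := integrableD measurableT ic iW'.
have := @le_Rintegral _ _ _ nu setT F _ measurableT iF
  (integrableD measurableT icW iL) (fun w _ => ptw w).
rewrite {1}/Rintegral F0 /=.
rewrite RintegralD// RintegralD// Rintegral_prob_cst RintegralZl//.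
have hW : (k%:R * (2 * J))^-1 * \int[nu]_w exp_weight H k u (w.1 + h) <= k%:R^-1.
  by rewrite invfM -mulrA ger_pMr ?invr_gt0// mulrC ler_pdivrMr// mul1r.
set T1 := _^-1 * _ in hW *; set T2 := \int[nu]_w L _ _.
have -> : - (ln (exp_action H k u) / k%:R) =
   (ln 2 + d.+1%:R * ln k%:R) / k%:R - ln (2 * J) / k%:R.
  by rewrite lnJ -/I; field; rewrite gt_eqF.
rewrite /c mulrBl mul1r; lra.
Qed.

End lower_bound.

(** * Passage to the limit *)

(** The slope [t] comes from [ln k = ln (t k) - ln t <= t k - ln t]; it is small
    enough for [n t <= e / 2], and the constants are absorbed by the other half. *)
Lemma ln_over_n_small (R : realType) (n : nat) (e : R) : 0 < e ->
  \forall k \near \oo, (0 < k)%N ->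
    (ln 2 + n%:R * ln k%:R) / k%:R <= e.
Proof.
move=> e0; pose t := e / (2 * n.+1%:R).
have n0 : (0 : R) < n.+1%:R by rewrite ltr0n.
have t0 : 0 < t by rewrite divr_gt0// mulr_gt0.
near=> k => k0.
have kp : (0 : R) < k%:R by rewrite ltr0n.
rewrite ler_pdivrMr//.
have lnk : ln k%:R <= t * k%:R - ln t.
  rewrite lerBrDl -lnM ?posrE//; apply: ltW; apply: ln_sublinear.
  exact: mulr_gt0.
have : n%:R * ln k%:R <= n%:R * (t * k%:R - ln t) by rewrite ler_wpM2l.
have : n%:R * t <= e / 2.
  have -> : e / 2 = n.+1%:R * t by rewrite /t; field; rewrite nat1r gt_eqF.
  by rewrite ler_wpM2r ?ler_nat// ltW.
move=> h1; have : n%:R * t * k%:R <= e / 2 * k%:R by rewrite ler_wpM2r// ltW.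
have : 2 / e * (ln 2 - n%:R * ln t) <= k%:R by near: k; exact: nbhs_infty_ger.
rewrite -ler_pdivlMl ?divr_gt0// invf_div => h2 h3 h4.
by rewrite mulrBr in h4; lra.
Unshelve. all: by end_near. Qed.

Lemma cvge_gt_near (R : realType) (v : nat -> \bar R) (l c : \bar R) :
  (c < l)%E -> v n @[n --> \oo] --> l -> \forall n \near \oo, (c < v n)%E.
Proof.
move=> cl vl; have : nbhs l [set y | (c < y)%E].
  by apply: open_nbhs_nbhs; split=> //; exact: open_ereal_gt_ereal.
by move=> /vl.
Qed.

Section actions.
Context (R : realType) (d : nat) (eta : R -> 'rV[R]_d) (V : spacetime R d -> R).
Context (eta_per : periodic eta 1) (eta_cont : continuous eta).
Context (V_fun : torus_function V).
Let H := mechanical_hamiltonian eta V.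
Local Notation L := (lagrangian eta V).

(** The Lagrangian dominates a quarter of the squared speed up to a constant, so a
    finite action controls the second moment. *)
Lemma second_moment_of_action (nu : probability (phase R d) R) :
  (\int[nu]_w (L w.1 w.2)%:E < +oo)%E -> second_moment nu.
Proof.
move=> Loo; have [C C0 HC] := lagrangian_growth eta_per eta_cont V_fun.
have mL : measurable_fun setT (fun w : phase R d => (L w.1 w.2)%:E).
  apply/measurable_EFinP; apply: measurable_phase_function.
  exact: phase_function_lagrangian.
have md : measurable_fun setT (fun w : phase R d => (dot w.2 w.2)%:E).
  apply/measurable_EFinP; apply: measurable_phase_function.
  exact: phase_function_dot.
have mp := measurable_funepos mL; have mn := measurable_funeneg mL.
have negC : (\int[nu]_w ((fun w => (L w.1 w.2)%:E)^\- w) <= C%:E)%E.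
  apply: (@le_trans _ _ (\int[nu]_w C%:E)%E); last first.
    rewrite integral_cst// [X in (_ * X)%E](_ : _ = 1%E) ?mule1//.
    exact: probability_setT.
  apply: ge0_le_integral => // w _.
  rewrite funenegE ge_max !lee_fin C0 andbT.
  by have := (HC w.1 w.2).2; have := dot_ge0 w.2; lra.
have posoo : (\int[nu]_w ((fun w => (L w.1 w.2)%:E)^\+ w) < +oo)%E.
  have nfin : (\int[nu]_w ((fun w => (L w.1 w.2)%:E)^\- w))%E \is a fin_num.
    rewrite ge0_fin_numE; first exact: le_lt_trans negC (ltry _).
    by apply: integral_ge0.
  by move: Loo; rewrite integralE lteBlDr// -(fineK nfin) addye.
apply/integrableP; split => //.
apply: (@le_lt_trans _ _ (\int[nu]_w (4%:E * ((fun w => (L w.1 w.2)%:E)^\+ w + C%:E)))%E).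
  apply: ge0_le_integral => //.
  - exact: measurableT_comp.
  - by apply: measurable_funeM; apply: emeasurable_funD.
  - move=> w _; rewrite gee0_abs ?lee_fin ?dot_ge0//.
    rewrite funeposE; have := (HC w.1 w.2).2 => h.
    apply: (@le_trans _ _ (4%:E * ((L w.1 w.2)%:E + C%:E))%E).
      by rewrite -EFinD -EFinM lee_fin; lra.
    by rewrite lee_pmul2l// leeD2r// le_max lexx.
rewrite ge0_integralZl//; last 2 first.
  by apply: emeasurable_funD.
  by move=> w _; rewrite adde_ge0// ?lee_fin// funepos_ge0.
rewrite ge0_integralD//.
rewrite lte_mul_pinfty// lte_add_pinfty//.
rewrite integral_cst// [X in (_ * X)%E](_ : _ = 1%E) ?mule1 ?ltry//.
exact: probability_setT.
Qed.

Lemma action_integrable (nu : probability (phase R d) R) :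
  second_moment nu -> nu.-integrable setT (fun w => (L w.1 w.2)%:E).
Proof.
move=> i2; have := lagrangian_translate_integrable eta_per eta_cont V_fun 0 i2.
by under eq_fun do rewrite addr0.
Qed.

Lemma cvg_translates (h : nat -> spacetime R d) :
  (forall k, (0 < k)%N -> (forall i, 0 <= (h k).1 ord0 i <= k%:R^-1) /\
    0 <= (h k).2 <= k%:R^-1) ->
  h n @[n --> \oo] --> (0 : spacetime R d).
Proof.
move=> hk.
have small (e : R) : 0 < e -> \forall n \near \oo, (0 < n)%N /\ (n%:R^-1 : R) < e.
  move=> e0; have [N _ HN] := near_infty_natSinv_lt (PosNum e0).
  exists N.+1 => // -[//|n] /= Nn; split=> //; exact: HN.
have h1 : (h n).1 @[n --> \oo] --> (0 : 'rV[R]_d).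
  apply/cvgrPdist_lt => e e0; apply: filterS (small e e0) => n [n0 ne].
  rewrite sub0r normrN [ltLHS]/Num.norm/= mx_normrE.
  apply/bigmax_ltP; split=> // -[i j] _ /=; rewrite (ord1 i).
  by have [/(_ j)/andP[a0 a1] _] := hk n n0; rewrite ger0_norm// (le_lt_trans a1).
have h2 : (h n).2 @[n --> \oo] --> (0 : R).
  apply/cvgrPdist_lt => e e0; apply: filterS (small e e0) => n [n0 ne].
  rewrite sub0r normrN.
  by have [_ /andP[a0 a1]] := hk n n0; rewrite ger0_norm// (le_lt_trans a1).
have := cvgn_pair h1 h2.
by apply: cvg_trans; apply: near_eq_cvg; apply: nearW => n; case: (h n).
Qed.

Lemma eventually_le_action (u : nat -> spacetime R d -> R)
    (u_min : forall k, (0 < k)%N -> smooth_minimizer H k (u k))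
    (nu : probability (phase R d) R) (e : R) :
  admissible nu -> second_moment nu -> 0 < e ->
  \forall k \near \oo, (0 < k)%N ->
    - (ln (exp_action H k (u k)) / k%:R) <= \int[nu]_w L w.1 w.2 + e.
Proof.
move=> adm i2 e0.
have /choice[h Hh] : forall k, exists h : spacetime R d, (0 < k)%N ->
    [/\ forall i, 0 <= h.1 ord0 i <= k%:R^-1, 0 <= h.2 <= k%:R^-1 &
    - (ln (exp_action H k (u k)) / k%:R) <=
      (ln 2 + d.+1%:R * ln k%:R) / k%:R + \int[nu]_w L (w.1 + h) w.2].
  move=> [|k]; first by exists 0.
  have [pu su _ _] := u_min k.+1 isT.
  have [h Hh] := minimizer_lower_bound eta_per eta_cont V_fun (ltn0Sn k)
    (su 1%N) pu adm i2.
  by exists h.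
have h0 : h n @[n --> \oo] --> (0 : spacetime R d).
  by apply: cvg_translates => k k0; have [] := Hh k k0.
have e2 : 0 < e / 2 by rewrite divr_gt0.
have /cvgrPdist_le/(_ _ e2) := cvg_lagrangian_translate eta_per eta_cont V_fun i2 h0.
move=> near1; have near2 := @ln_over_n_small R d.+1 _ e2.
apply: filterS2 near1 near2 => k k1 k2 k0.
have [_ _ k3] := Hh k k0; have {}k2 := k2 k0.
by move: k1; rewrite ler_norml => /andP[k1 _]; lra.
Qed.

End actions.

Section weak_limit.
Context (R : realType) (d : nat).
Context (mun : nat -> probability (phase R d) R) (mu : probability (phase R d) R).
Context (mu_lim : weak_cvg_phase (fun n => mun n) mu).

(** Weak convergence only tests bounded functions; the truncations [min F n] are
    bounded, increase to [F], and one of them already integrates to more than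
    [c]. *)
Lemma weak_cvg_lsc (F : phase R d -> R) (c : R) :
  phase_function F -> (forall w, 0 <= F w) ->
  (c%:E < \int[mu]_w (F w)%:E)%E ->
  \forall n \near \oo, (c%:E < \int[mun n]_w (F w)%:E)%E.
Proof.
move=> pF F0 cF; have mF := measurable_phase_function pF.
pose G (n : nat) w := Num.min (F w) n%:R.
have pG n : phase_function (G n).
  apply: (phase_function_comp (h := fun x => Num.min x n%:R)) => // x.
  by apply: (@continuous_min _ _ id (fun=> n%:R)); [exact: cvg_id|exact: cvg_cst].
have G0 n w : 0 <= G n w by rewrite le_min F0 ler0n.
have mG n : measurable_fun setT (EFin \o G n).
  by apply/measurable_EFinP; exact: measurable_phase_function.
have Gcvg : (\int[mu]_w (G n w)%:E @[n --> \oo] --> \int[mu]_w (F w)%:E)%E.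
  have Glim w : (G n w)%:E @[n --> \oo] --> (F w)%:E.
    apply: cvg_near_cst; near=> n; congr EFin; apply/min_idPl.
    by near: n; exact: nbhs_infty_ger.
  have -> : (\int[mu]_w (F w)%:E = \int[mu]_w limn (fun n => (G n w)%:E))%E.
    by apply: eq_integral => w _; apply/esym/cvg_lim => //; exact: Glim.
  apply: cvg_monotone_convergence => //.
  - by move=> n w _; rewrite lee_fin.
  - move=> w _ a b ab; rewrite lee_fin /G le_min ge_min lexx/=.
    by rewrite ge_min ler_nat ab orbT.
have [n cG] : exists n, (c%:E < \int[mu]_w (G n w)%:E)%E.
  have [N _ HN] := cvge_gt_near cF Gcvg.
  by exists N; exact: (HN N (leqnn N)).
have Gb : exists M, forall w, `|G n w| <= M.
  by exists n%:R => w; rewrite ger0_norm// ge_min lexx orbT.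
have := cvge_gt_near cG (mu_lim (pG n).1 (pG n).2 Gb).
apply: filterS => j /= cj; apply: lt_le_trans cj _.
apply: ge0_le_integral => //.
- by move=> w _; rewrite lee_fin.
- exact: mG.
- by apply/measurable_EFinP.
- by move=> w _; rewrite lee_fin ge_min lexx.
Unshelve. all: by end_near. Qed.

Lemma weak_cvg_le (F : phase R d -> R) (c : R) :
  phase_function F -> (forall w, 0 <= F w) ->
  (\forall n \near \oo, (\int[mun n]_w (F w)%:E <= c%:E)%E) ->
  (\int[mu]_w (F w)%:E <= c%:E)%E.
Proof.
move=> pF F0 Fc; rewrite leNgt; apply/negP => /(weak_cvg_lsc pF F0) cF.
have := filterI Fc cF => -[N _ /(_ N (leqnn N)) [h1 h2]].
by move: (lt_le_trans h2 h1); rewrite ltxx.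
Qed.

Context (B : R) (B0 : 0 <= B).
Context (mun2 : \forall n \near \oo,
  (\int[mun n]_w (dot w.2 w.2)%:E <= B%:E)%E).

Lemma weak_cvg_second_moment :
  (\int[mu]_w (dot w.2 w.2)%:E <= B%:E)%E /\ second_moment mu.
Proof.
have le : (\int[mu]_w (dot w.2 w.2)%:E <= B%:E)%E.
  apply: (weak_cvg_le (F := fun w => dot w.2 w.2)) => //.
    exact: phase_function_dot.
  by move=> w; exact: dot_ge0.
split=> //; apply/integrableP; split.
  apply/measurable_EFinP; apply: measurable_phase_function.
  exact: phase_function_dot.
under eq_integral do rewrite gee0_abs ?lee_fin ?dot_ge0//.
exact: le_lt_trans le (ltry _).
Qed.

(** A function of linear growth is not a legitimate test function for weak
    convergence, but adding a small multiple [s] of the squared speed and a constant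
    makes it nonnegative; lower semicontinuity then applies, the constant cancels
    and the second moments contribute at most [s * B]. *)
Lemma weak_cvg_linear_le0 (F : phase R d -> R) (C D : R) :
  phase_function F -> (forall w, `|F w| <= C + D * dot w.2 w.2) ->
  (forall e, 0 < e ->
    exists2 K, 0 <= K & forall w, - (e * dot w.2 w.2 + K) <= F w) ->
  (forall n, second_moment (mun n)) ->
  (forall n, \int[mun n]_w (F w)%:E = 0)%E ->
  (\int[mu]_w F w <= 0).
Proof.
move=> pF Fq Flow i2 F0; have [_ mu2] := weak_cvg_second_moment.
have iF (nu : probability (phase R d) R) : second_moment nu ->
    nu.-integrable setT (EFin \o F).
  move=> nu2; apply: quadratic_growth_integrable nu2 _ Fq.
  exact: measurable_phase_function.
apply/ler_addgt0Pr => e e0; rewrite add0r.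
have B1 : 0 < B + 1 by rewrite ltr_wpDl.
have [K K0 HK] := Flow (e / (B + 1)) (divr_gt0 e0 B1).
pose s := e / (B + 1); have s0 : 0 <= s by rewrite divr_ge0// ltW.
pose G w := F w + (s * dot w.2 w.2 + K).
have ptail : phase_function (fun w : phase R d => s * dot w.2 w.2 + K).
  apply: phase_functionD; last exact: phase_function_cst.
  by apply: phase_functionM; [exact: phase_function_cst|exact: phase_function_dot].
have pG : phase_function G by exact: phase_functionD.
have G0 w : 0 <= G w by have := HK w; rewrite -/s /G; lra.
have iK (nu : probability (phase R d) R) : nu.-integrable setT (EFin \o (fun=> K)).
  by apply: (@integrable_bounded _ _ _ nu (fun=> K) `|K|).
have iS (nu : probability (phase R d) R) : second_moment nu ->
    nu.-integrable setT (EFin \o (fun w => s * dot w.2 w.2)).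
  by move=> nu2; exact: (integrableZl measurableT s nu2).
have iT (nu : probability (phase R d) R) : second_moment nu ->
    nu.-integrable setT (EFin \o (fun w => s * dot w.2 w.2 + K)).
  by move=> nu2; exact: (integrableD measurableT (iS _ nu2) (iK nu)).
have GE (nu : probability (phase R d) R) : second_moment nu ->
    (\int[nu]_w (G w)%:E = \int[nu]_w (F w)%:E +
      (s * (\int[nu]_w dot w.2 w.2) + K)%:E)%E.
  move=> nu2; rewrite /G.
  rewrite (integralD measurableT (iF _ nu2) (iT _ nu2)); congr (_ + _)%E.
  rewrite -[LHS]fineK; last exact: integrable_fin_num (iT _ nu2).
  congr EFin; rewrite -/(Rintegral nu setT (fun w => s * dot w.2 w.2 + K)).
  rewrite (RintegralD measurableT (iS _ nu2) (iK nu)) Rintegral_prob_cst.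
  by rewrite RintegralZl.
have : (\int[mu]_w (G w)%:E <= (s * B + K)%:E)%E.
  apply: weak_cvg_le => //; apply: filterS mun2 => n hn.
  rewrite GE// F0 add0e lee_fin lerD2r ler_wpM2l//.
  by rewrite -lee_fin [leLHS]fineK//; exact: integrable_fin_num (i2 n).
rewrite GE// -[X in (X + _)%E]fineK; last exact: integrable_fin_num (iF _ mu2).
rewrite -EFinD lee_fin -/(Rintegral mu setT F) addrA lerD2r => h.
have h2 : 0 <= s * \int[mu]_w dot w.2 w.2.
  by rewrite mulr_ge0//; apply: Rintegral_ge0 => w _; exact: dot_ge0.
have h3 : s * B <= e.
  by rewrite /s mulrAC ler_pdivrMr// ler_wpM2l ?ltW// ltrDl.
by lra.
Qed.

(** The constraint is linear in the test function, so it suffices to apply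
    [weak_cvg_linear_le0] to the integrand and to its opposite. *)
Lemma weak_cvg_admissible : phase_measure mu ->
  (forall n, second_moment (mun n)) -> (forall n, admissible (mun n)) ->
  admissible mu.
Proof.
move=> mu1 i2 adm; have [_ mu2] := weak_cvg_second_moment; split=> //.
  have iE : mu.-integrable setT (EFin \o (fun w : phase R d => enorm w.2)).
    apply: (quadratic_growth_integrable (C := 1) (D := 1)) => //.
      exact: measurable_phase_function (phase_function_enorm R d).
    move=> w; rewrite ger0_norm ?enorm_ge0// mul1r -enorm_sqr.
    by have := sqr_ge0 (enorm w.2 - 2^-1); lra.
  have /integrableP[_] := iE.
  by under eq_integral do rewrite gee0_abs ?lee_fin ?enorm_ge0//.
move=> phi pp Cp.
pose F (w : phase R d) := dt phi w.1 + dot (grad phi w.1) w.2.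
have tdt : torus_function (dt phi) by exact: torus_function_dt.
have tg i : torus_function (fun z => grad phi z ord0 i) by exact: torus_function_grad.
have pF : phase_function F.
  apply: phase_functionD; first exact: phase_function_base.
  exact: phase_function_dot_base.
have [M M0 HM] := torus_functionP tdt.
have [K K0 HK] := torus_functionP (torus_function_dot tg tg).
have bound e w : 0 < e -> `|F w| <= e * dot w.2 w.2 + (M + (4 * e)^-1 * K).
  move=> e0; apply: le_trans (ler_normD _ _) _.
  have h1 := HM w.1; have := HK w.1; rewrite ger0_norm ?dot_ge0// => h2.
  have := norm_dot_le (grad phi w.1) w.2 e0.
  have : (4 * e)^-1 * dot (grad phi w.1) (grad phi w.1) <= (4 * e)^-1 * K.
    by rewrite ler_wpM2l// invr_ge0 mulr_ge0// ltW.
  by lra.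
have iF : mu.-integrable setT (EFin \o F).
  apply: (quadratic_growth_integrable (C := M + (4 * 1)^-1 * K) (D := 1)) => //.
    exact: measurable_phase_function.
  by move=> w; rewrite addrC; exact: bound.
have F0 n : (\int[mun n]_w (F w)%:E = 0)%E by have [_ _] := adm n; exact.
have K1 e : 0 < e -> 0 <= M + (4 * e)^-1 * K.
  by move=> e0; rewrite addr_ge0 ?mulr_ge0 ?invr_ge0 ?mulr_ge0// ltW.
have le1 : \int[mu]_w F w <= 0.
  apply: (weak_cvg_linear_le0 (C := M + (4 * 1)^-1 * K) (D := 1)) => //.
    by move=> w; rewrite addrC; exact: bound.
  move=> e e0; exists (M + (4 * e)^-1 * K); first exact: K1.
  by move=> w; have := bound e w e0; rewrite ler_norml => /andP[].
have le2 : \int[mu]_w (-1 * F w) <= 0.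
  apply: (weak_cvg_linear_le0 (C := M + (4 * 1)^-1 * K) (D := 1)) => //.
  - by apply: phase_functionM => //; exact: phase_function_cst.
  - by move=> w; rewrite mulN1r normrN addrC; exact: bound.
  - move=> e e0; exists (M + (4 * e)^-1 * K); first exact: K1.
    by move=> w; have := bound e w e0; rewrite ler_norml => /andP[_]; lra.
  - move=> n; under eq_integral do rewrite EFinM.
    rewrite integralZl//; first by rewrite F0 mule0.
    apply: (quadratic_growth_integrable (C := M + (4 * 1)^-1 * K) (D := 1)) => //.
      exact: measurable_phase_function.
    by move=> w; rewrite addrC; exact: bound.
move: le2; rewrite RintegralZl// => le2.
rewrite -[LHS]fineK; last exact: integrable_fin_num iF.
by congr EFin; rewrite -/(Rintegral mu setT F); lra.
Qed.

End weak_limit.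

(** * Mather measures and vanishing entropy *)

Theorem proposition3 (R : realType) (d : nat)
    (eta : R -> 'rV[R]_d) (V : spacetime R d -> R)
    (eta_per : periodic eta 1) (eta_smooth : smooth eta)
    (V_per : torus_periodic V) (V_smooth : smooth V)
    (H : spacetime R d -> 'rV[R]_d -> R)
    (H_def : H = mechanical_hamiltonian eta V)
    (u : nat -> spacetime R d -> R)
    (u_min : forall k, (0 < k)%N -> smooth_minimizer H k (u k))
    (muk : nat -> probability (phase R d) R)
    (muk_def : forall k, (0 < k)%N -> is_graph_measure H k (u k) (muk k))
    (kj : nat -> nat)
    (kj_pos : forall j, (0 < kj j)%N)
    (kj_incr : forall i j, (i < j)%N -> (kj i < kj j)%N)
    (mu : probability (phase R d) R)
    (mu_torus : phase_measure mu)
    (mu_lim : weak_cvg_phase (fun j => muk (kj j)) mu) :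
  is_mather H mu /\
  ((fun j => (((kj j)%:R^-1 : R)%:E * entropy (muk (kj j)))%E) @ \oo
     --> (0%:E : \bar R)).
Proof.
subst H; set H := mechanical_hamiltonian eta V.
have eta_cont : continuous eta by exact: (eta_smooth 0%N).
have V_fun : torus_function V by split=> //; exact: (V_smooth 0%N).
pose L (w : phase R d) := lagrangian eta V w.1 w.2.
have legE : (fun w : phase R d => legendre H w.1 w.2) = EFin \o L.
  by apply/funext => w /=; exact: legendre_mechanical.
have pL : phase_function L by exact: phase_function_lagrangian.
have muk2 k : (0 < k)%N -> second_moment (muk k).
  move=> k0; apply: (graph_integrable eta_per eta_cont V_fun (u_min k k0)
    (muk_def k k0) (phase_function_dot R d)).
have mukA k : (0 < k)%N -> admissible (muk k).
  by move=> k0; exact: graph_admissible (u_min k k0) (muk k) (muk_def k k0).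
pose a k := \int[muk k]_w L w.
pose h k := ln (exp_action H k (u k)) / k%:R.
pose s k := min_entropy eta V k (u k) / k%:R.
have intL k : (0 < k)%N -> (muk k).-integrable setT (EFin \o L).
  by move=> k0; exact: (action_integrable eta_per eta_cont V_fun (muk2 k k0)).
have aE k : (0 < k)%N -> a k = - h k - s k.
  move=> k0; have := graph_energy eta_per eta_cont V_fun k0 (u_min k k0) (muk_def k k0).
  by rewrite /a /Rintegral => ->.
have s0 k : (0 < k)%N -> 0 <= s k.
  move=> k0; rewrite divr_ge0//.
  exact: (min_entropy_ge0 eta_per eta_cont V_fun (u_min k k0) (muk_def k k0)).
have kj_ge j : (j <= kj j)%N.
  by elim: j => [//|j IH]; exact: leq_ltn_trans IH (kj_incr _ _ (ltnSn j)).
have along (P : nat -> Prop) : (\forall k \near \oo, (0 < k)%N -> P k) ->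
    \forall j \near \oo, P (kj j).
  move=> [N _ HN]; exists N => // j /= Nj; apply: HN => //=.
  exact: leq_trans Nj (kj_ge j).
have [C C0 HC] := lagrangian_growth eta_per eta_cont V_fun.
have upper (nu : probability (phase R d) R) e : admissible nu ->
    second_moment nu -> 0 < e ->
    \forall j \near \oo, - h (kj j) <= \int[nu]_w L w + e.
  move=> nuA nu2 e0.
  apply: (along (fun k => - h k <= \int[nu]_w L w + e)).
  exact: (eventually_le_action eta_per eta_cont V_fun u_min nuA nu2 e0).
(* The measure of index 1 has a smooth density, hence finite action: as a
   competitor it bounds the actions from above, and so the second moments. *)
pose B := 4 * (`|a 1%N| + 1 + C).
have B0 : 0 <= B by rewrite mulr_ge0// !addr_ge0.
have muB : \forall j \near \oo,
    (\int[muk (kj j)]_w (dot w.2 w.2)%:E <= B%:E)%E.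
  have := upper (muk 1%N) 1 (mukA 1%N isT) (muk2 1%N isT) ltr01.
  apply: filterS => j hj.
  have i2 := muk2 _ (kj_pos j).
  rewrite -[leLHS]fineK; last exact: integrable_fin_num i2.
  rewrite lee_fin -/(Rintegral (muk (kj j)) setT (fun w => dot w.2 w.2)).
  have iq : (muk (kj j)).-integrable setT
      (EFin \o (fun w : phase R d => 4^-1 * dot w.2 w.2)).
    exact: (integrableZl measurableT 4^-1 i2).
  have iC : (muk (kj j)).-integrable setT (EFin \o (fun=> C)).
    by apply: (@integrable_bounded _ _ _ _ (fun=> C) `|C|).
  have : \int[muk (kj j)]_w (4^-1 * dot w.2 w.2 - C) <= a (kj j).
    apply: le_Rintegral => //.
    - exact: (integrableB measurableT iq iC).
    - exact: intL.
    - by move=> w _; exact: (HC w.1 w.2).2.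
  rewrite RintegralB// Rintegral_prob_cst RintegralZl// aE//.
  have := s0 _ (kj_pos j); have := ler_norm (a 1%N); rewrite /B -/(a 1%N) in hj *.
  by move: hj; rewrite -/(a 1%N); lra.
have [_ mu2] := weak_cvg_second_moment mu_lim muB.
have muA : admissible mu.
  apply: (weak_cvg_admissible mu_lim B0 muB) => // j.
    exact: muk2.
  exact: mukA.
have iLmu : mu.-integrable setT (EFin \o L).
  exact: (action_integrable eta_per eta_cont V_fun mu2).
(* Adding [C] makes the Lagrangian nonnegative, as lower semicontinuity asks. *)
have lower e : 0 < e -> \forall j \near \oo, \int[mu]_w L w - e <= a (kj j).
  move=> e0; pose F w := L w + C.
  have pF : phase_function F.
    by apply: phase_functionD => //; exact: phase_function_cst.
  have F0 w : 0 <= F w.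
    by have := (HC w.1 w.2).2; have := dot_ge0 w.2; rewrite /F /L; lra.
  have iC (nu : probability (phase R d) R) : nu.-integrable setT (EFin \o (fun=> C)).
    by apply: (@integrable_bounded _ _ _ _ (fun=> C) `|C|).
  have FE (nu : probability (phase R d) R) : nu.-integrable setT (EFin \o L) ->
      (\int[nu]_w (F w)%:E = (\int[nu]_w L w + C)%:E)%E.
    move=> iL; rewrite -[LHS]fineK; last first.
      exact: (integrable_fin_num measurableT (integrableD measurableT iL (iC nu))).
    congr EFin; rewrite -/(Rintegral nu setT F).
    by rewrite (RintegralD measurableT iL (iC nu)) Rintegral_prob_cst.
  have := @weak_cvg_lsc _ _ _ _ mu_lim F (\int[mu]_w L w + C - e) pF F0.
  rewrite FE// lte_fin ltrBlDr ltrDl => /(_ e0).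
  apply: filterS => j; rewrite FE; last exact: intL.
  by rewrite lte_fin /a => /ltW; lra.
split.
  split=> // nu nuA; rewrite legE.
  have [nuoo|] := ltP (\int[nu]_w (EFin \o L) w)%E +oo%E; last first.
    by rewrite leye_eq => /eqP ->; rewrite leey.
  have nu2 : second_moment nu by exact: second_moment_of_action nuoo.
  have iLnu := action_integrable eta_per eta_cont V_fun nu2.
  rewrite -[leLHS]fineK; last exact: integrable_fin_num iLmu.
  rewrite -[leRHS]fineK; last exact: integrable_fin_num iLnu.
  rewrite lee_fin -/(Rintegral mu setT L) -/(Rintegral nu setT L).
  apply/ler_addgt0Pr => e e0; have e2 : 0 < e / 2 by rewrite divr_gt0.
  have [N _ /(_ N (leqnn N)) [h1 h2]] := filterI (lower _ e2) (upper nu _ nuA nu2 e2).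
  have := s0 _ (kj_pos N); move: h1; rewrite aE// => h1 h3; lra.
(* [s = - h - a], and [- h] and [a] are squeezed together at the action of [mu]. *)
have scvg : s (kj j) @[j --> \oo] --> 0.
  apply/cvgrPdist_le => e e0; have e2 : 0 < e / 2 by rewrite divr_gt0.
  apply: filterS2 (lower _ e2) (upper mu _ muA mu2 e2) => j h1 h2.
  rewrite sub0r normrN ger0_norm ?s0//.
  by move: h1; rewrite aE// => h1; lra.
apply: (@squeeze_cvge _ _ _ _ (fun=> 0%E) _ (fun j => (s (kj j))%:E)).
- apply: nearW => j; rewrite mule_ge0 ?entropy_ge0 ?lee_fin//=.
  rewrite /s mulrC EFinM lee_wpmul2l ?lee_fin//.
  exact: (graph_entropy_le eta_per eta_cont V_fun (u_min _ (kj_pos j))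
    (muk_def _ (kj_pos j))).
- exact: cvg_cst.
- by apply: cvg_EFin => //; exact: nearW.
Qed.
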